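(* Let $\mathbf{u}\in\Sigma=T^3$. There exists a neighborhood $V$ of $\mathbf{u}$ in $\Sigma$ such that $\mathbf{v}\in V$ is scale-equivalent to $\mathbf{u}$ if and only if it belongs to the orbit of $\mathbf{u}$ under the flow of the vector field $$Z=\sum_{k=1}^3\sin(2\varphi_k)\,\sin(\varphi_\ell+\varphi_m-\varphi_k)\,\frac{\partial}{\partial\varphi_k},$$ where for each $k$, $\{k,\ell,m\}=\{1,2,3\}$.
   Context: A point of $\Sigma=T^3$ is written $\mathbf{u}=(e^{i\varphi_1},e^{i\varphi_2},e^{i\varphi_3})$. For $\mathbf{u}\in\Sigma$, $C_{\mathrm{alg}}(\mathbb{R}^4_{\mathbf{u}})$ is the complex unital algebra generated by $x^0,x^1,x^2,x^3$ with the quadratic relations $$\cos(\varphi_k)[x^0,x^k]_-=i\sin(\varphi_\ell-\varphi_m)[x^\ell,x^m]_+,\qquad \cos(\varphi_\ell-\varphi_m)[x^\ell,x^m]_-=-i\sin(\varphi_k)[x^0,x^k]_+$$ for every cyclic permutation $(k,\ell,m)$ of $(1,2,3)$, where $[x,y]_\pm=xy\pm yx$. It is graded by giving degree $1$ to the $x^\mu$. Two points $\mathbf{u},\mathbf{v}\in\Sigma$ are called scale-equivalent if the quadratic algebras $C_{\mathrm{alg}}(\mathbb{R}^4_{\mathbf{u}})$ and $C_{\mathrm{alg}}(\mathbb{R}^4_{\mathbf{v}})$ are isomorphic (as graded complex algebras; no compatibility with the involution is required). *)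

(* Defs.v *)
From HB Require Import structures.
From mathcomp Require Import all_boot all_order all_algebra.
From mathcomp Require Import generic_quotient ring_quotient complex.
From mathcomp Require Import all_classical all_reals all_analysis.
From mathcomp Require finmap.
(* The notations of monalg clash with those of mathcomp-analysis. *)
From mathcomp Require Import -(notations) monalg.

Set Implicit Arguments.
Unset Strict Implicit.
Unset Printing Implicit Defensive.

Import Order.TTheory GRing.Theory Num.Theory.
Import numFieldNormedType.Exports.

Local Open Scope classical_set_scope.
Local Open Scope ring_scope.
Local Open Scope quotient_scope.

Section QuotientAlgebra.
Variables (K : fieldType) (A : algType K).

Definition two_sided_ideal (I : set A) : Prop :=
  [/\ I 0, forall p q, I p -> I q -> I (p - q),
      forall a p, I p -> I (a * p) & forall a p, I p -> I (p * a)].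

Definition generated_ideal (S : set A) : set A := smallest two_sided_ideal S.

Lemma generated_ideal_two_sided S : two_sided_ideal (generated_ideal S).
Proof.
split=> [I [[]]//|p q Ip Iq I II|a p Ip I II|a p Ip I II].
- by case: (II) => -[_ IB _ _] _; apply: IB; [apply: Ip|apply: Iq].
- by case: (II) => -[_ _ IM _] _; apply: IM; apply: Ip.
- by case: (II) => -[_ _ _ IM] _; apply: IM; apply: Ip.
Qed.

(* MathComp's algebras are nontrivial, hence the properness condition. *)
Record proper_ideal := ProperIdeal {
  ideal_set : set A;
  ideal_two_sided : two_sided_ideal ideal_set;
  ideal_proper : ~ ideal_set 1
}.

Variable I : proper_ideal.

Definition ideal_pred : {pred A} := fun p => `[< ideal_set I p >].

Lemma ideal_pred_zmod : zmod_closed ideal_pred.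
Proof.
have [I0 IB _ _] := ideal_two_sided I.
by split=> [|p q /asboolP Ip /asboolP Iq]; apply/asboolP => //; apply: IB.
Qed.

HB.instance Definition _ := GRing.isZmodClosed.Build A ideal_pred
  ideal_pred_zmod.

(* The additive quotient A / I is that of ring_quotient, which has a ring
   structure only for commutative A. *)
Definition quotient_algebra : Type := Quotient.quot ideal_pred.

HB.instance Definition _ := GRing.Zmodule.on quotient_algebra.

Definition quot_pi (p : A) : quotient_algebra :=
  \pi_(Quotient.quot ideal_pred) p.

Definition quot_repr (x : quotient_algebra) : A :=
  repr (x : Quotient.quot ideal_pred).

Lemma quot_piP p q : quot_pi p = quot_pi q <-> ideal_set I (p - q).
Proof.
have := Quotient.idealrBE ideal_pred p q.
rewrite -[_ \in _]/`[< ideal_set I (p - q) >] => e.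
by split=> [h|/asboolP]; [apply/asboolP; rewrite e; apply/eqP|rewrite e => /eqP].
Qed.

Lemma quot_reprK : cancel quot_repr quot_pi.
Proof. by move=> x; exact: reprK. Qed.

Lemma quot_repr_pi p : ideal_set I (quot_repr (quot_pi p) - p).
Proof. by apply/quot_piP; rewrite quot_reprK. Qed.

Lemma quot_piB : {morph quot_pi : p q / p - q}.
Proof. by move=> p q; rewrite /quot_pi raddfB. Qed.

HB.instance Definition _ :=
  GRing.isZmodMorphism.Build A quotient_algebra quot_pi quot_piB.

Lemma quot_ind (P : quotient_algebra -> Prop) :
  (forall p, P (quot_pi p)) -> forall x, P x.
Proof. by move=> H x; rewrite -(quot_reprK x). Qed.

Definition quot_one : quotient_algebra := quot_pi 1.
Definition quot_mul (x y : quotient_algebra) : quotient_algebra :=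
  quot_pi (quot_repr x * quot_repr y).
Definition quot_scale (a : K) (x : quotient_algebra) : quotient_algebra :=
  quot_pi (a *: quot_repr x).

Lemma quot_pi_mul p q : quot_mul (quot_pi p) (quot_pi q) = quot_pi (p * q).
Proof.
have [_ _ IMl IMr] := ideal_two_sided I.
transitivity (quot_pi (p * quot_repr (quot_pi q))); apply/quot_piP.
- by rewrite -mulrBl; apply: IMr; exact: quot_repr_pi.
- by rewrite -mulrBr; apply: IMl; exact: quot_repr_pi.
Qed.

Lemma quot_pi_scale a p : quot_scale a (quot_pi p) = quot_pi (a *: p).
Proof.
have [_ _ IMl _] := ideal_two_sided I.
apply/quot_piP; rewrite -scalerBr -[X in a *: X]mul1r scalerAl.
by apply: IMl; exact: quot_repr_pi.
Qed.

Lemma quot_mulA : associative quot_mul.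
Proof.
elim/quot_ind=> p; elim/quot_ind=> q; elim/quot_ind=> r.
by rewrite !quot_pi_mul mulrA.
Qed.

Lemma quot_mul1r : left_id quot_one quot_mul.
Proof. by elim/quot_ind=> p; rewrite quot_pi_mul mul1r. Qed.

Lemma quot_mulr1 : right_id quot_one quot_mul.
Proof. by elim/quot_ind=> p; rewrite quot_pi_mul mulr1. Qed.

Lemma quot_mulDl : left_distributive quot_mul +%R.
Proof.
elim/quot_ind=> p; elim/quot_ind=> q; elim/quot_ind=> r.
by rewrite -raddfD !quot_pi_mul -raddfD mulrDl.
Qed.

Lemma quot_mulDr : right_distributive quot_mul +%R.
Proof.
elim/quot_ind=> p; elim/quot_ind=> q; elim/quot_ind=> r.
by rewrite -raddfD !quot_pi_mul -raddfD mulrDr.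
Qed.

Lemma quot_oner_neq0 : quot_one != 0.
Proof.
apply/eqP; rewrite -[0](raddf0 quot_pi) => /quot_piP.
by rewrite subr0; exact: ideal_proper.
Qed.

HB.instance Definition _ := GRing.Zmodule_isNzRing.Build quotient_algebra
  quot_mulA quot_mul1r quot_mulr1 quot_mulDl quot_mulDr quot_oner_neq0.

Lemma quot_scalerA a b x : quot_scale a (quot_scale b x) = quot_scale (a * b) x.
Proof. by elim/quot_ind: x => p; rewrite !quot_pi_scale scalerA. Qed.

Lemma quot_scale1r : left_id 1 quot_scale.
Proof. by elim/quot_ind=> p; rewrite quot_pi_scale scale1r. Qed.

Lemma quot_scalerDr : right_distributive quot_scale +%R.
Proof.
move=> a; elim/quot_ind=> p; elim/quot_ind=> q.
by rewrite -raddfD !quot_pi_scale -raddfD scalerDr.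
Qed.

Lemma quot_scalerDl x : {morph quot_scale^~ x : a b / a + b}.
Proof.
move=> a b; elim/quot_ind: x => p.
by rewrite !quot_pi_scale -raddfD scalerDl.
Qed.

HB.instance Definition _ := GRing.Zmodule_isLmodule.Build K quotient_algebra
  quot_scalerA quot_scale1r quot_scalerDr quot_scalerDl.

Lemma quot_piM (p q : A) : quot_pi (p * q) = quot_pi p * quot_pi q.
Proof. by rewrite -quot_pi_mul. Qed.

Lemma quot_piZ (a : K) (p : A) : quot_pi (a *: p) = a *: quot_pi p.
Proof. by rewrite -quot_pi_scale. Qed.

Lemma quot_scalerAl (a : K) (x y : quotient_algebra) :
  a *: (x * y) = (a *: x) * y.
Proof.
elim/quot_ind: x => p; elim/quot_ind: y => q.
by rewrite -quot_piM -!quot_piZ -quot_piM scalerAl.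
Qed.

HB.instance Definition _ :=
  GRing.Lmodule_isLalgebra.Build K quotient_algebra quot_scalerAl.

Lemma quot_scalerAr (a : K) (x y : quotient_algebra) :
  a *: (x * y) = x * (a *: y).
Proof.
elim/quot_ind: x => p; elim/quot_ind: y => q.
by rewrite -quot_piM -!quot_piZ -quot_piM scalerAr.
Qed.

HB.instance Definition _ :=
  GRing.Lalgebra_isAlgebra.Build K quotient_algebra quot_scalerAr.

Lemma quot_pi_monoid_morphism : monoid_morphism quot_pi.
Proof. by split=> // p q; exact: quot_piM. Qed.

HB.instance Definition _ := GRing.isMonoidMorphism.Build A quotient_algebra
  quot_pi quot_pi_monoid_morphism.

HB.instance Definition _ := GRing.isScalable.Build K A quotient_algebra *:%R
  quot_pi quot_piZ.

End QuotientAlgebra.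

Lemma malg_scalerAr (M : monomType) (K : comNzRingType) (a : K)
  (p q : malg M K) : a *: (p * q) = p * (a *: q).
Proof.
apply/malgP => w; rewrite mcoeffZ.
have -> := mcoeffMlw w (finmap.fsubset_refl (msupp p)) (msuppZ_le a q).
have -> := mcoeffMl p q w.
rewrite mulr_sumr; apply: eq_bigr => k _; rewrite mulr_sumr.
by apply: eq_bigr => l _; rewrite mcoeffZ mulrnAr mulrCA.
Qed.

Section FreeAlgebra.
Variable K : fieldType.

(* The free associative algebra K<x^0, x^1, x^2, x^3>: the words in the x^mu
   form a basis. *)
Definition free_algebra : Type := malg (fmonom 'I_4) K.

HB.instance Definition _ := GRing.Lalgebra.on free_algebra.

HB.instance Definition _ :=
  GRing.Lalgebra_isAlgebra.Build K free_algebra (@malg_scalerAr _ K).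

Definition free_gen (mu : 'I_4) : free_algebra := mkmalgU (fmu mu) 1.

Definition free_graded (n : nat) : set free_algebra :=
  [set p | forall w : fmonom 'I_4, mcoeff w p != 0 -> fdeg w = n].

Definition free_aug : free_algebra -> K := mcoeff mone.

Fact free_aug_zmod_morphism : zmod_morphism free_aug.
Proof. exact: (raddfB (@mcoeff (fmonom 'I_4) K mone)). Qed.

Fact free_aug_monoid_morphism : monoid_morphism free_aug.
Proof. by have [fM f1] := mcoeff1g_is_multiplicative (fmonom 'I_4) K. Qed.

Fact free_aug_scalable : scalable_for *%R free_aug.
Proof. by move=> a p; exact: mcoeffZ. Qed.

HB.instance Definition _ :=
  GRing.isZmodMorphism.Build free_algebra K free_aug free_aug_zmod_morphism.
HB.instance Definition _ :=
  GRing.isMonoidMorphism.Build free_algebra K free_aug free_aug_monoid_morphism.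
HB.instance Definition _ :=
  GRing.isScalable.Build K free_algebra K *%R free_aug free_aug_scalable.

Lemma free_aug_gen mu : free_aug (free_gen mu) = 0.
Proof. by rewrite /free_aug /free_gen mcoeffU fm1_eq1. Qed.

End FreeAlgebra.

Definition comm_minus (A : pzRingType) (x y : A) : A := x * y - y * x.
Definition comm_plus (A : pzRingType) (x y : A) : A := x * y + y * x.

Lemma ker_two_sided_ideal (K : fieldType) (A : algType K)
  (f : {rmorphism A -> K}) : two_sided_ideal [set p | f p = 0].
Proof.
split=> [|p q /= p0 q0|a p /= p0|a p /= p0]; first exact: rmorph0.
- by rewrite rmorphB p0 q0 subrr.
- by rewrite rmorphM p0 mulr0.
- by rewrite rmorphM p0 mul0r.
Qed.

Lemma rmorph_relation0 (K : fieldType) (A : algType K)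
    (f : {lrmorphism A -> K | *%R}) (a b : K) (x y z t : A) :
  f x = 0 -> f z = 0 -> f (a *: comm_minus x y - b *: comm_plus z t) = 0.
Proof.
have fZ c w : f (c *: w) = c * f w by exact: scalarZ.
have fM v w : f (v * w) = f v * f w by exact: rmorphM.
have fB v w : f (v - w) = f v - f w by exact: raddfB.
have fD v w : f (v + w) = f v + f w by exact: raddfD.
move=> fx fz; rewrite /comm_minus /comm_plus fB !fZ fB fD !fM fx fz.
by rewrite !(mul0r, mulr0, subrr, addr0).
Qed.

Section Torus.
Variable R : realType.

Definition expi (x : R) : R[i] := (cos x +i* sin x)%C.

(* R[i]^o is R[i] equipped with the topology of its norm. *)
Definition Sigma : set 'rV[R[i]^o]_3 := [set u | forall k, `|u ord0 k| = 1].

Definition torus_point (phi : 'rV[R]_3) : 'rV[R[i]^o]_3 :=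
  \row_k expi (phi ord0 k).

(* The indices 1, 2, 3 are the elements 0, 1, 2 of 'I_3 = Z/3, so the cyclic
   permutations (k, l, m) of (1, 2, 3) are the triples (k, k + 1, k + 2). *)
Definition vector_field_Z (phi : 'rV[R]_3) : 'rV[R]_3 :=
  \row_k (let: l := k + 1 in let: m := k + 2%:R in
    sin (2 * phi ord0 k) * sin (phi ord0 l + phi ord0 m - phi ord0 k)).

(* Sigma is compact and Z is smooth, so the flow of Z is complete and the orbit
   of u is the image of the integral curve through u, defined on the whole of
   R.  Integral curves are written in the angular coordinates phi, i.e. lifted
   to the universal cover R^3 of Sigma. *)
Definition flow_orbit (u : 'rV[R[i]^o]_3) : set 'rV[R[i]^o]_3 :=
  [set v | exists gamma : R -> 'rV[R]_3,
    [/\ forall s : R, is_derive s (1 : R) gamma (vector_field_Z (gamma s)),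
        torus_point (gamma 0) = u
      & exists t : R, torus_point (gamma t) = v]].

End Torus.

Section QuadraticAlgebra.
Variable R : realType.
Local Notation F := (free_algebra R[i]).
Local Notation "a %:C" := (real_complex R a).
Local Notation x0 := (free_gen R[i] ord0).
Local Notation x_ j := (free_gen R[i] (lift ord0 j)).

Definition relation1 (phi : 'rV[R]_3) (k : 'I_3) : F :=
  let: l := k + 1 in let: m := k + 2%:R in
  (cos (phi ord0 k))%:C *: comm_minus x0 (x_ k)
  - ('i%C * (sin (phi ord0 l - phi ord0 m))%:C) *: comm_plus (x_ l) (x_ m).

Definition relation2 (phi : 'rV[R]_3) (k : 'I_3) : F :=
  let: l := k + 1 in let: m := k + 2%:R in
  (cos (phi ord0 l - phi ord0 m))%:C *: comm_minus (x_ l) (x_ m)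
  - (- 'i%C * (sin (phi ord0 k))%:C) *: comm_plus x0 (x_ k).

(* The relations are 2 pi-periodic in each angle, so all the angles phi of u
   give the same relations. *)
Definition quadratic_relations (u : 'rV[R[i]^o]_3) : set F :=
  [set r | exists2 phi : 'rV[R]_3, u = torus_point phi &
           exists k : 'I_3, r = relation1 phi k \/ r = relation2 phi k].

Lemma quadratic_relations_proper u :
  ~ generated_ideal (quadratic_relations u) 1.
Proof.
move=> /(_ [set p | free_aug p = 0]) f1.
suff: free_aug (1 : F) = 0 by move/eqP; rewrite rmorph1 oner_eq0.
apply: f1; split; first exact: ker_two_sided_ideal.
by move=> r [phi _ [k []]] ->; apply: rmorph_relation0; exact: free_aug_gen.
Qed.

Definition relation_ideal (u : 'rV[R[i]^o]_3) : proper_ideal F :=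
  ProperIdeal (generated_ideal_two_sided (quadratic_relations u))
    (@quadratic_relations_proper u).

Definition C_alg (u : 'rV[R[i]^o]_3) : algType R[i] :=
  quotient_algebra (relation_ideal u).

Definition C_alg_graded (u : 'rV[R[i]^o]_3) (n : nat) : set (C_alg u) :=
  quot_pi (relation_ideal u) @` @free_graded R[i] n.

Arguments C_alg_graded u n : clear implicits.

Definition scale_equivalent (u v : 'rV[R[i]^o]_3) : Prop :=
  exists f : {lrmorphism C_alg u -> C_alg v},
    bijective f /\ forall n, f @` C_alg_graded u n = C_alg_graded v n.

End QuadraticAlgebra.

(* Main.v *)
(* Put phi_0 = 0.  The degree 2 part of the relations of C_alg(u) is the space of
   matrices g_ij cos (phi_i - phi_j) - i (star g)_ij sin (phi_i - phi_j) with g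
   antisymmetric, so a graded isomorphism is a T in GL_4 exchanging two such spaces.

   Along the flow of Z, the sines and cosines of the phi_i - phi_j solve scalar
   linear equations f' = a f.  Hence they are multiplied by positive factors, and a
   diagonal T exchanges the relations.

   Conversely, let T exchange the relations of v and u, with v close to u.  The
   dimensions of the symmetric and antisymmetric parts show that the same sines and
   cosines vanish at u and v, and T maps enough vanishing entries to vanishing
   entries to force each product tan (phi_i - phi_l) tan (phi_j - phi_m) at v to be
   one of finitely many values at u, hence the corresponding one by continuity.
   If Z_k is nonzero at u, the orbit of u reaches the coordinate phi_k of v, and
   these equations determine v from phi_k.  If Z vanishes at u, they give v = u. *)
Require Import Defs.
From HB Require Import structures.
From mathcomp Require Import all_boot all_order all_algebra complex.
From mathcomp Require Import all_classical all_reals all_analysis.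
From mathcomp Require Import -(notations) finmap.
From mathcomp Require Import -(notations) monalg.
From mathcomp Require Import ring lra.
Set Implicit Arguments.
Unset Strict Implicit.
Unset Printing Implicit Defensive.
Import Order.TTheory GRing.Theory Num.Theory.
Import numFieldNormedType.Exports.
Local Open Scope classical_set_scope.
Local Open Scope ring_scope.

(** Why only products of tangents survive: on the diagonal, and wherever sin (phi_a - phi_b) = 0,
    the relations of u have no symmetric part. Pulled back by T, this says that the rows meeting a
    given column of T have angles of v congruent mod pi. So T is monomial when the four angles are
    distinct mod pi, and otherwise a block matrix in the cases that matter. Its nonzero entries stay
    unknown, but they cancel when the two relations exchanged by the Hodge star are multiplied. Only
    the permutation of the generators remains undetermined, which is why continuity has to select
    the value. Closeness alone gives only that nonzero sines and cosines of u stay nonzero at v. The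
    converse comes from dimensions: T embeds the larger space of supported matrices into the smaller
    one. The same tangent products are first integrals of Z, because phi_l - phi_m evolves by the
    law of phi_k with the opposite sign of the speed. An orbit requires a curve defined on all of R,
    so Picard iteration is run on the whole line at once, in an exponentially weighted norm. *)

Section OrdinaryDifferentialEquation.

(** * Antiderivatives and global flows of bounded Lipschitz vector fields *)

Variable R : realType.
Implicit Types f g F G : R -> R.

Lemma is_derive_continuous f df x : is_derive x (1 : R) f df -> {for x, continuous f}.
Proof.
by move=> [dfx _]; apply: differentiable_continuous; exact/derivable1_diffP.
Qed.

Lemma is_derive_ge0_le f df a b : a <= b ->
  (forall x, is_derive x (1 : R) f (df x)) -> (forall x, 0 <= df x) -> f a <= f b.
Proof.
move=> ab fdf df0.
have [|x _] := MVT_segment ab (fun x _ => fdf x).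
  by apply: continuous_subspaceT => x; exact: is_derive_continuous.
by move=> e; rewrite -subr_ge0 e mulr_ge0// subr_ge0.
Qed.

(** The antiderivative is the integral from a fixed left end [a], so it is controlled only to the
    right of [a]. *)
Lemma continuous_has_antiderivative_gt f (a : R) : continuous f ->
  exists F, forall x, a < x -> is_derive x (1 : R) F (f x).
Proof.
move=> cf; exists (fun x => (\int[lebesgue_measure]_(t in `[a, x]) f t)%R) => x ax.
have xx1 : x < x + 1 by rewrite ltrDl.
have [|dF FE] := @continuous_FTC1_closed R f a x (x + 1) xx1 _ ax (cf x).
  apply: continuous_compact_integrable; first exact: segment_compact.
  exact: continuous_subspaceT.
by split; [exact: dF|rewrite -FE derive1E].
Qed.

Lemma continuous_has_antiderivative f : continuous f ->
  exists2 F, F 0 = 0 & forall x, is_derive x (1 : R) F (f x).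
Proof.
move=> cf.
have [F Ff] := continuous_has_antiderivative_gt (-1) cf.
have cfN : continuous (fun x => f (- x)).
  by move=> x; apply: (@continuous_comp _ _ _ -%R f); [exact: oppr_continuous|exact: cf].
have [G Gf] := continuous_has_antiderivative_gt (-1) cfN.
have GNf (x : R) : x < 1 -> is_derive x (1 : R) (fun y => - G (- y)) (f x).
  move=> x1.
  have h : is_derive (- x) (1 : R) G (f x) by rewrite -{2}(opprK x); apply: Gf; rewrite ltrN2.
  have -> : f x = - (f x * - 1) by rewrite mulrN1 opprK.
  exact: is_deriveN.
(* On the overlap of their domains, [F] and the reflected antiderivative [- G (- y)] have the same
   derivative, so they differ by a constant and can be glued at -1. *)
have FG (x : R) : -1 < x -> x < 1 -> F x - F 0 = G 0 - G (- x).
  move=> x1 x2.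
  pose H y := F y + G (- y).
  suff HE : H x = H 0.
    by move: HE; rewrite /H oppr0 => /eqP; rewrite addrC -subr_eq => /eqP <-; ring.
  have dH (y : R) : -1 < y -> y < 1 -> is_derive y (1 : R) H 0.
    move=> y1 y2; rewrite -(subrr (f y)).
    have := is_deriveB (Ff y y1) (GNf y y2).
    by apply: near_eq_is_derive; near=> z; rewrite /H/= !fctE opprK.
  have itv1 y : y \in `[Num.min 0 x, Num.max 0 x] -> -1 < y /\ y < 1.
    rewrite in_itv/= => /andP[y1 y2]; split.
      by rewrite (lt_le_trans _ y1)// lt_min x1 ltrN10.
    by rewrite (le_lt_trans y2)// gt_max x2 ltr01.
  have [|||c _] := @MVT_segment R H (cst 0) (Num.min 0 x) (Num.max 0 x).
  - by rewrite ge_min !le_max !lexx.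
  - by move=> y /subset_itv_oo_cc /itv1[]; exact: dH.
  - by apply: derivable_within_continuous => y /itv1[y1 y2]; have [] := dH y y1 y2.
  - rewrite mul0r; by case: (ltP 0 x) => _ /eqP; rewrite subr_eq0 => /eqP.
exists (fun x => if -1 < x then F x - F 0 else G 0 - G (- x)).
  by rewrite ltrN10 subrr.
move=> x; have [x1|x1] := ltP (-1) x.
  have := is_deriveB (Ff x x1) (@is_derive_cst R R R (F 0) x 1); rewrite subr0.
  apply: near_eq_is_derive; near=> z.
  by rewrite !fctE ifT//; near: z; exact: lt_nbhsr.
have x1' : x < 1 by rewrite (le_lt_trans x1)// ltrN11.
have := is_deriveD (@is_derive_cst R R R (G 0) x 1) (GNf x x1'); rewrite add0r.
apply: near_eq_is_derive; near=> z.
rewrite !fctE; case: ifP => // z1; rewrite FG//.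
by near: z; exact: lt_nbhsl.
Unshelve. all: by end_near. Qed.

(** The intervals of radius [e n = 2 * C / 2 ^+ n] around [u n] are nested, since
    [e n = e n.+1 + C / 2 ^+ n]. The limit is the supremum of their left ends. *)
Lemma geometric_cauchy_limit (u : nat -> R) (C : R) :
  (forall n, `|u n.+1 - u n| <= C / 2 ^+ n) ->
  exists l, forall n, `|l - u n| <= 2 * C / 2 ^+ n.
Proof.
move=> uC.
have C0 : 0 <= C by have := uC 0%N; rewrite expr0 divr1; apply: le_trans.
pose e n := 2 * C / 2 ^+ n.
have eS n : e n = e n.+1 + C / 2 ^+ n.
  by rewrite /e exprS invfM; field; rewrite expf_neq0.
have e0 n : 0 <= e n by rewrite divr_ge0 ?exprn_ge0// mulr_ge0.
have am n k : u n - e n <= u (n + k)%N - e (n + k)%N.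
  elim: k => [|k]; first by rewrite addn0.
  move/le_trans; apply; rewrite addnS.
  have := uC (n + k)%N; rewrite ler_norml (eS (n + k)%N) => /andP[h _]; lra.
have bm n k : u (n + k)%N + e (n + k)%N <= u n + e n.
  elim: k => [|k]; first by rewrite addn0.
  apply: le_trans; rewrite addnS.
  have := uC (n + k)%N; rewrite ler_norml (eS (n + k)%N) => /andP[_ h]; lra.
have ab n m : u n - e n <= u m + e m.
  have [h|/ltnW h] := leqP n m.
    by have := am n (m - n)%N; rewrite subnKC// => /le_trans; apply; have := e0 m; lra.
  by have := bm m (n - m)%N; rewrite subnKC//; apply: le_trans; have := e0 n; lra.
pose S := [set y | exists n, y = u n - e n].
have hS : has_sup S.
  by split; [exists (u 0%N - e 0%N), 0%N|exists (u 0%N + e 0%N) => _ [n ->]].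
exists (sup S) => n; rewrite ler_norml -/(e n).
have h1 : u n - e n <= sup S by apply: sup_ubound; [case: hS|exists n].
have h2 : sup S <= u n + e n by apply: sup_le_ub; [case: hS|move=> _ [m ->]].
by apply/andP; split; lra.
Qed.

(** A smooth substitute for exp (K |t|): it handles both directions of time, and integrating it
    gains a factor 1 / K. *)
Definition weight (K t : R) : R := expR (K * t) + expR (- K * t).

Lemma weight_ge0 K t : 0 <= weight K t.
Proof. by rewrite addr_ge0 ?expR_ge0. Qed.

(* |G'| <= C w integrates to |G| <= C |W| <= C w / K where W' = w, W odd. *)
Lemma weight_bound G g (K C : R) : 0 < K -> 0 <= C -> G 0 = 0 ->
  (forall x, is_derive x (1 : R) G (g x)) ->
  (forall x, `|g x| <= C * weight K x) ->
  forall x, `|G x| <= C / K * weight K x.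
Proof.
move=> K0 C0 G0 Gg gw x.
pose W y := (C / K) * (expR (K * y) - expR (- K * y)).
have dK (c y : R) : is_derive y (1 : R) (fun z => expR (c * z)) (c * expR (c * y)).
  have h : is_derive y (1 : R) (fun z => c * z) c.
    by have := @is_deriveZ R R R id c y 1 1 _; rewrite /GRing.scale/= mulr1; apply.
  by rewrite mulrC; exact: (is_derive1_comp (is_derive_expR _) h).
have dW y : is_derive y (1 : R) W (C * weight K y).
  have h := is_deriveZ (C / K) (is_deriveB (dK K y) (dK (- K) y)).
  apply: (is_derive_eq h); rewrite /weight /GRing.scale/=.
  by field; exact: lt0r_neq0.
have WG s : s = 1 \/ s = -1 -> {homo (fun y => W y + s * G y) : a b / a <= b}.
  move=> s1 a b ab.
  have dWG y : is_derive y (1 : R) (fun y => W y + s * G y) (C * weight K y + s * g y).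
    exact: is_deriveD (dW y) (is_deriveZ s (Gg y)).
  apply: (is_derive_ge0_le ab dWG) => y.
  by have := gw y; rewrite ler_norml => /andP[]; case: s1 => ->; lra.
have W0 : W 0 = 0 by rewrite /W !mulr0 subrr mulr0.
have Ww : `|W x| <= C / K * weight K x.
  rewrite /W normrM ger0_norm ?divr_ge0 ?(ltW K0)// ler_wpM2l ?divr_ge0 ?(ltW K0)//.
  by rewrite ler_norml /weight; have := expR_ge0 (K * x); have := expR_ge0 (- K * x); lra.
apply: le_trans Ww.
have [x0|/ltW x0] := leP 0 x.
  have := WG 1 (or_introl erefl) _ _ x0; have := WG (-1) (or_intror erefl) _ _ x0.
  rewrite W0 G0 => h1 h2; apply: le_trans (ler_norm _).
  by rewrite ler_norml; apply/andP; split; lra.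
have := WG 1 (or_introl erefl) _ _ x0; have := WG (-1) (or_intror erefl) _ _ x0.
rewrite W0 G0 => h1 h2; rewrite -[`|W x|]normrN; apply: le_trans (ler_norm _).
by rewrite ler_norml; apply/andP; split; lra.
Qed.

Lemma le_add_geometric (a b c : R) :
  (forall n, a <= b + c / 2 ^+ n) -> a <= b.
Proof.
move=> h; apply/ler_addgt0Pr => e e0.
pose n := (Num.truncn (`|c| / e)).+1.
apply: (le_trans (h n)); rewrite lerD2l ler_pdivrMr ?exprn_gt0//.
rewrite (le_trans (ler_norm c))// mulrC -ler_pdivrMr//.
have h1 : `|c| / e < n%:R by rewrite truncnS_gt.
apply: (le_trans (ltW h1)); rewrite -natrX ler_nat; exact: ltnW (ltn_expl _ _).
Qed.

Lemma row_norm_leP n (x : 'rV[R]_n) (c : R) : 0 <= c ->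
  `|x| <= c <-> forall k, `|x ord0 k| <= c.
Proof.
move=> c0; rewrite [`|x|]mx_normrE; split.
  by move=> h k; apply: le_trans h; exact: (le_bigmax _ _ (ord0, k)).
by move=> h; apply: bigmax_le => // -[i j] _ /=; rewrite ord1.
Qed.

Lemma is_derive_rowP n (f : R -> 'rV[R]_n) (t : R) (d : 'rV[R]_n) :
  is_derive t (1 : R) f d <->
  forall k, is_derive t (1 : R) (fun s => f s ord0 k) (d ord0 k).
Proof.
split=> [[dft fd] k|h].
  have /derivable_mxP h := dft.
  by split; [exact: h|rewrite -fd derive_mx// mxE].
have dft : derivable f t 1.
  by apply/derivable_mxP => i k; rewrite (ord1 i); case: (h k).
split => //; rewrite derive_mx//; apply/rowP => k; rewrite mxE.
by case: (h k).
Qed.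

Lemma row_has_antiderivative n (f : R -> 'rV[R]_n) (x0 : 'rV[R]_n) :
  continuous f ->
  exists2 F, F 0 = x0 & forall t, is_derive t (1 : R) F (f t).
Proof.
move=> cf.
have /choice[G HG] k : exists G, G 0 = 0 /\
    forall t, is_derive t (1 : R) G (f t ord0 k).
  have [|G G0 dG] := @continuous_has_antiderivative (fun t => f t ord0 k).
    move=> t; apply: (@continuous_comp _ _ _ f (fun M : 'rV[R]_n => M ord0 k)).
      exact: cf.
    exact: coord_continuous.
  by exists G.
exists (fun t => x0 + \row_k G k t).
  by apply/rowP => k; rewrite !mxE (HG k).1 addr0.
move=> t; apply/is_derive_rowP => k.
have -> : (fun s => (x0 + \row_j G j s) ord0 k) = cst (x0 ord0 k) + G k.
  by apply/funext => s; rewrite !mxE.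
have h := is_deriveD (@is_derive_cst R R R (x0 ord0 k) t 1) ((HG k).2 t).
by apply: (is_derive_eq h); rewrite add0r.
Qed.

Lemma row_weight_bound n (F G f g : R -> 'rV[R]_n) (K C : R) :
  0 < K -> 0 <= C -> F 0 = G 0 ->
  (forall t, is_derive t (1 : R) F (f t)) ->
  (forall t, is_derive t (1 : R) G (g t)) ->
  (forall t, `|f t - g t| <= C * weight K t) ->
  forall t, `|F t - G t| <= C / K * weight K t.
Proof.
move=> K0 C0 FG0 dF dG fg t.
have h0 c s : 0 <= c -> 0 <= c * weight K s.
  by move=> c0; rewrite mulr_ge0 ?weight_ge0.
apply/row_norm_leP => [|k]; first by rewrite h0// divr_ge0// ltW.
have /= := @weight_bound (fun s => (F s - G s) ord0 k)
  (fun s => (f s - g s) ord0 k) K C K0 C0 _ _ _ t; apply.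
- by rewrite FG0 subrr mxE.
- move=> s; have /is_derive_rowP := is_deriveB (dF s) (dG s); exact.
- by move=> s; have /row_norm_leP := fg s; apply; exact: h0.
Qed.

Lemma is_derive_lipschitz n (f df : R -> 'rV[R]_n) (B : R) : 0 <= B ->
  (forall t, is_derive t (1 : R) f (df t)) -> (forall t, `|df t| <= B) ->
  forall s t, `|f t - f s| <= B * `|t - s|.
Proof.
move=> B0 fdf dfB s t.
wlog st : s t / s <= t => [wl|].
  have [|/ltW h] := leP s t; first exact: wl.
  by rewrite distrC [X in B * X]distrC; exact: wl.
apply/row_norm_leP => [|k]; first exact: mulr_ge0.
have dk x : is_derive x (1 : R) (fun s => f s ord0 k) (df x ord0 k).
  by have /is_derive_rowP := fdf x; exact.
have [|x _] := MVT_segment st (fun x _ => dk x).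
  by apply: continuous_subspaceT => x; exact: is_derive_continuous.
rewrite !mxE => ->; rewrite normrM ler_wpM2r//.
by have /row_norm_leP := dfB x; exact.
Qed.

Lemma lipschitz_is_continuous (V W : normedModType R) (f : V -> W) (L : R) :
  (forall s t, `|f t - f s| <= L * `|t - s|) -> continuous f.
Proof.
move=> fL x; apply/cvgrPdist_le => e e0; near=> y.
have L1 : 0 < `|L| + 1 by rewrite ltr_wpDl.
rewrite (le_trans (fL _ _))// (@le_trans _ _ ((`|L| + 1) * `|x - y|))//.
  by rewrite ler_wpM2r// (le_trans (ler_norm _))// lerDl.
rewrite mulrC -ler_pdivlMr//.
by near: y; apply: cvgr_dist_le => //; exact: divr_gt0.
Unshelve. all: by end_near. Qed.

Section Picard.
Variables (n : nat) (F : 'rV[R]_n -> 'rV[R]_n) (L B : R).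
Hypothesis L0 : 0 < L.
Hypothesis FL : forall x y, `|F x - F y| <= L * `|x - y|.
Hypothesis FB : forall x, `|F x| <= B.

(** With this rate [L / K] is 1/2, so a Picard step halves the weighted distance; [C] bounds the
    first step. *)
Let K := 2 * L.
Let K0 : 0 < K. Proof. by rewrite mulr_gt0. Qed.
Let B0 : 0 <= B. Proof. exact: le_trans (FB 0). Qed.
Let C := B / K.
Let C0 : 0 <= C. Proof. by rewrite divr_ge0// ltW. Qed.
Let w := weight K.

Theorem bounded_lipschitz_flow (x0 : 'rV[R]_n) :
  exists2 gamma : R -> 'rV[R]_n, gamma 0 = x0 &
    forall t, is_derive t (1 : R) gamma (F (gamma t)).
Proof.
have cF : continuous F by apply: (@lipschitz_is_continuous _ _ _ L) => s t; exact: FL.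
have cFo (f : R -> 'rV[R]_n) : continuous f -> continuous (F \o f).
  by move=> cf t; apply: continuous_comp; [exact: cf|exact: cF].
(* [T] is the Picard operator. Choice needs a total function, so a discontinuous [f] gets the
   default [T f = f]; the iterates are all [B]-Lipschitz, hence continuous. *)
have /choice[T HT] (f : R -> 'rV[R]_n) : exists G : R -> 'rV[R]_n, continuous f ->
    G 0 = x0 /\ forall t, is_derive t (1 : R) G (F (f t)).
  have [cf|ncf] := pselect (continuous f); last by exists f.
  by have [G G0 dG] := row_has_antiderivative x0 (cFo _ cf); exists G.
pose u m := iter m T (cst x0).
have lipT (f : R -> 'rV[R]_n) : continuous f -> forall s t, `|T f t - T f s| <= B * `|t - s|.
  by move=> /HT[_ dT]; apply: (is_derive_lipschitz B0 dT) => t; exact: FB.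
have lip m s t : `|u m t - u m s| <= B * `|t - s|.
  elim: m s t => [|m IH] s t; first by rewrite subrr normr0 mulr_ge0.
  by apply: lipT; apply: (@lipschitz_is_continuous _ _ _ B).
have cu m : continuous (u m).
  by apply: (@lipschitz_is_continuous _ _ _ B) => s t; exact: lip.
have w1 t : 1 <= w t.
  rewrite /w /weight; have [h|h] := leP 0 (K * t).
    have := expR_ge0 (- K * t); have : 1 <= expR (K * t) by rewrite -expR0 ler_expR.
    lra.
  have := expR_ge0 (K * t); have : 1 <= expR (- K * t).
    by rewrite -expR0 ler_expR mulNr oppr_ge0 ltW.
  lra.
have w0 t : 0 <= w t by exact: weight_ge0.
have step m t : `|u m.+1 t - u m t| <= C * w t / 2 ^+ m.
  have pow2 k : 0 <= (2 ^+ k)^-1 :> R by rewrite invr_ge0 exprn_ge0.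
  elim: m t => [|m IH] t.
    rewrite expr0 divr1.
    apply: (@row_weight_bound _ _ _ (fun s => F x0) (cst 0) K B) => //.
    - exact: (HT _ (cu 0%N)).1.
    - exact: (HT _ (cu 0%N)).2.
    - move=> s; rewrite subr0 (le_trans (FB _))// -[leLHS]mulr1 ler_wpM2l//.
  have -> : C * w t / 2 ^+ m.+1 = (L * (C / 2 ^+ m)) / K * w t.
    by rewrite /K exprS; field; rewrite expf_neq0//= lt0r_neq0.
  apply: (row_weight_bound K0 _ _ (HT _ (cu m.+1)).2 (HT _ (cu m)).2).
  - by apply: mulr_ge0; [exact: ltW|exact: mulr_ge0].
  - exact: (etrans (HT _ (cu m.+1)).1 (esym (HT _ (cu m)).1)).
  - move=> s; rewrite (le_trans (FL _ _))// -[leRHS]mulrA ler_wpM2l ?(ltW L0)//.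
    by rewrite [leRHS]mulrAC; exact: IH.
have /choice[X XP] t : exists x : 'rV[R]_n,
    forall m, `|x - u m t| <= 2 * (C * w t) / 2 ^+ m.
  have /choice[x xP] k : exists x, forall m,
      `|x - u m t ord0 k| <= 2 * (C * w t) / 2 ^+ m.
    apply: (@geometric_cauchy_limit (fun m => u m t ord0 k)) => m.
    have cw : 0 <= C * w t / 2 ^+ m by rewrite divr_ge0 ?exprn_ge0// mulr_ge0.
    by have /(row_norm_leP _ cw)/(_ k) := step m t; rewrite !mxE.
  exists (\row_k x k) => m; apply/row_norm_leP => [|k].
    by rewrite divr_ge0 ?exprn_ge0// mulr_ge0// mulr_ge0.
  by rewrite !mxE.
have lipX s t : `|X t - X s| <= B * `|t - s|.
  apply: (@le_add_geometric _ _ (2 * (C * w t) + 2 * (C * w s))) => m.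
  have := XP t m; have := XP s m; have := lip m s t; rewrite [(_ + _) / _]mulrDl.
  have -> : X t - X s = (X t - u m t) + (u m t - u m s) - (X s - u m s).
    by rewrite subrKA opprB subrKA.
  have := ler_normB ((X t - u m t) + (u m t - u m s)) (X s - u m s).
  have := ler_normD (X t - u m t) (u m t - u m s).
  set a := `|_ + _ - _|; set b := `|_ + _|; lra.
have cX : continuous X.
  by apply: (@lipschitz_is_continuous _ _ _ B) => s t; exact: lipX.
have [T0 dT] := HT _ cX.
(* [u m.+1] lies within a multiple of 2^-m of both [X] and [T X], at each fixed time. *)
suff XT : X = T X by exists X => [|t]; [rewrite XT|rewrite {1}XT; exact: dT].
apply/funext => t; apply/eqP; rewrite -subr_eq0 -normr_eq0 eq_le normr_ge0 andbT.
apply: (@le_add_geometric _ _ (2 * (C * w t))) => m; rewrite add0r.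
have h : `|u m.+1 t - T X t| <= (L * (2 * C / 2 ^+ m)) / K * w t.
  apply: (row_weight_bound K0 _ _ (HT _ (cu m)).2 dT).
  - by apply: mulr_ge0; [exact: ltW|rewrite divr_ge0 ?exprn_ge0// mulr_ge0].
  - exact: (etrans (HT _ (cu m)).1 (esym T0)).
  - move=> s; rewrite (le_trans (FL _ _))// -[leRHS]mulrA ler_wpM2l ?(ltW L0)//.
    by rewrite distrC [leRHS]mulrAC -[2 * C * _]mulrA; exact: XP.
have h' := XP t m.+1.
have -> : X t - T X t = (X t - u m.+1 t) + (u m.+1 t - T X t) by rewrite addrA subrK.
rewrite (le_trans (ler_normD _ _))//.
have -> : 2 * (C * w t) / 2 ^+ m = 2 * (C * w t) / 2 ^+ m.+1 + (L * (2 * C / 2 ^+ m)) / K * w t.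
  by rewrite /K exprS; field; rewrite expf_neq0//= lt0r_neq0.
exact: lerD.
Qed.
End Picard.
End OrdinaryDifferentialEquation.

(** * Two-sided ideals and commutators in algebras *)

Section TwoSidedIdeal.
Variables (K : fieldType) (A : algType K).
Implicit Types (I S : set A).

Lemma two_sided_ideal_add I p q : two_sided_ideal I -> I p -> I q -> I (p + q).
Proof.
move=> [I0 IB _ _] Ip Iq; have := IB _ _ Ip (IB _ _ I0 Iq).
by rewrite sub0r opprK.
Qed.

Lemma two_sided_ideal_scale I c p : two_sided_ideal I -> I p -> I (c *: p).
Proof.
by move=> [_ _ IM _] Ip; have := IM (c *: 1) _ Ip; rewrite -scalerAl mul1r.
Qed.

Lemma two_sided_ideal_pencil I (c a b a' b' : K) p q : two_sided_ideal I ->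
  c * a = a' -> c * b = b' -> I (a *: p - b *: q) -> I (a' *: p - b' *: q).
Proof.
by move=> II <- <- /(two_sided_ideal_scale c II); rewrite scalerBr !scalerA.
Qed.

Lemma generated_ideal_sub S : S `<=` generated_ideal S.
Proof. by move=> p Sp I [_]; exact. Qed.
End TwoSidedIdeal.

Section CommutatorMorphism.
Variables (K : fieldType) (A B : algType K).

Lemma lrmorphism_relation (f : {lrmorphism A -> B}) (a b : K) (x y z t : A) :
  f (a *: comm_minus x y - b *: comm_plus z t) =
  a *: comm_minus (f x) (f y) - b *: comm_plus (f z) (f t).
Proof.
have fB v w : f (v - w) = f v - f w by exact: raddfB.
have fD v w : f (v + w) = f v + f w by exact: raddfD.
have fZ c v : f (c *: v) = c *: f v by exact: linearZ_LR.
have fM v w : f (v * w) = f v * f w by exact: rmorphM.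
by rewrite /comm_minus /comm_plus fB !fZ fB fD !fM.
Qed.

Lemma comm_minusZ (a b : K) (x y : A) :
  comm_minus (a *: x) (b *: y) = (a * b) *: comm_minus x y.
Proof.
by rewrite /comm_minus -!scalerAl -!scalerAr !scalerA [b * a]mulrC scalerBr.
Qed.

Lemma comm_plusZ (a b : K) (x y : A) :
  comm_plus (a *: x) (b *: y) = (a * b) *: comm_plus x y.
Proof.
by rewrite /comm_plus -!scalerAl -!scalerAr !scalerA [b * a]mulrC scalerDr.
Qed.
End CommutatorMorphism.

(** * The degree 2 part of the free algebra as a space of 4 x 4 matrices *)

Section FreeAlgebraWords.
Variable K : fieldType.
Local Notation F := (free_algebra K).
Local Notation word := (fmonom 'I_4).
Implicit Types (a p : F) (w : word) (m : 'M[K]_4).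

Definition letter2 (i j : 'I_4) : word := mmul (fmu i) (fmu j).

(** If [p] starts in degree 2, every nonempty word of [a] pushes it to degree at least 3, so up to
    degree 2 only the constant term of [a] acts. *)
Lemma mcoeff_low_order_mull a p w : (forall v : word, (fdeg v < 2)%N -> mcoeff v p = 0) ->
  (fdeg w <= 2)%N -> mcoeff w (a * p) = mcoeff mone a * mcoeff w p.
Proof.
move=> p0 w2.
pose d := fsetU (@fset1 (word : choiceType) mone) (msupp a).
have ad : fsubset (msupp a) d by exact: fsubsetUr.
rewrite (mcoeffMlw w ad (fsubset_refl (msupp p))).
have d1 : (mone : word) \in d by rewrite in_fsetU in_fset1 eqxx.
rewrite (big_fsetD1 _ d1)/= [X in _ + X]big1_seq ?addr0; last first.
  move=> k /=; rewrite in_fsetD1 => /andP[k1 _].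
  rewrite big1// => v _; have [kv|//] := eqP; rewrite p0 ?mulr0//.
  have k0 : (0 < fdeg k)%N by rewrite lt0n fdeg_eq0.
  by apply: leq_trans w2; rewrite -kv fdegM -add1n leq_add2r.
rewrite [in RHS](monalgE p) raddf_sum mulr_sumr; apply: eq_bigr => v _.
by rewrite mul1m/= mcoeffU mulrnAr.
Qed.

Lemma mcoeff_low_order_mulr a p w : (forall v : word, (fdeg v < 2)%N -> mcoeff v p = 0) ->
  (fdeg w <= 2)%N -> mcoeff w (p * a) = mcoeff w p * mcoeff mone a.
Proof.
move=> p0 w2.
pose d := fsetU (@fset1 (word : choiceType) mone) (msupp a).
have ad : fsubset (msupp a) d by exact: fsubsetUr.
rewrite (mcoeffMrw w (fsubset_refl (msupp p)) ad).
have d1 : (mone : word) \in d by rewrite in_fsetU in_fset1 eqxx.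
rewrite (big_fsetD1 _ d1)/= [X in _ + X]big1_seq ?addr0; last first.
  move=> k /=; rewrite in_fsetD1 => /andP[k1 _].
  rewrite big1// => v _; have [kv|//] := eqP; rewrite p0 ?mul0r//.
  have k0 : (0 < fdeg k)%N by rewrite lt0n fdeg_eq0.
  by apply: leq_trans w2; rewrite -kv fdegM -addn1 leq_add2l.
rewrite [in RHS](monalgE p) raddf_sum mulr_suml; apply: eq_bigr => v _.
by rewrite mulm1/= mcoeffU mulrnAl.
Qed.

Definition quadratic_form m : F :=
  \sum_i \sum_j m i j *: (free_gen K i * free_gen K j).

Definition quadratic_part p : 'M[K]_4 := \matrix_(i, j) mcoeff (letter2 i j) p.

Lemma free_genM i j : free_gen K i * free_gen K j = mkmalgU (letter2 i j) 1.
Proof. by rewrite /free_gen malgM_def fgmulUU mulr1. Qed.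

Lemma letter2_inj i j k l : (letter2 i j == letter2 k l) = (i == k) && (j == l).
Proof. by rewrite fmP !fmM !fmU /= !eqseq_cons eqxx andbT. Qed.

Lemma fdeg_letter2 i j : fdeg (letter2 i j) = 2%N.
Proof. by rewrite fdegM !fdegU. Qed.

Lemma quadratic_form_is_linear : linear quadratic_form.
Proof.
move=> c m n; rewrite /quadratic_form scaler_sumr -big_split/=.
apply: eq_bigr => i _; rewrite scaler_sumr -big_split/=.
by apply: eq_bigr => j _; rewrite !mxE scalerDl scalerA.
Qed.
HB.instance Definition _ := GRing.isLinear.Build K 'M[K]_4 F *:%R quadratic_form
  quadratic_form_is_linear.

Lemma quadratic_part_is_linear : linear quadratic_part.
Proof. by move=> c p q; apply/matrixP => i j; rewrite !mxE mcoeffD mcoeffZ. Qed.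
HB.instance Definition _ := GRing.isLinear.Build K F 'M[K]_4 *:%R quadratic_part
  quadratic_part_is_linear.

Lemma mcoeff_quadratic_form m w :
  mcoeff w (quadratic_form m) = \sum_i \sum_j m i j *+ (letter2 i j == w).
Proof.
rewrite /quadratic_form raddf_sum; apply: eq_bigr => i _.
rewrite raddf_sum; apply: eq_bigr => j _.
by rewrite /= mcoeffZ free_genM mcoeffU mulr_natr.
Qed.

Lemma quadratic_formK : cancel quadratic_form quadratic_part.
Proof.
move=> m; apply/matrixP => i j; rewrite mxE mcoeff_quadratic_form.
rewrite (bigD1 i)//= (bigD1 j)//= eqxx mulr1n !big1 ?addr0// => [k ki|k kj].
  by rewrite big1// => l _; rewrite letter2_inj (negbTE ki).
by rewrite letter2_inj (negbTE kj) andbF.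
Qed.

Lemma quadratic_form_low m (w : word) : (fdeg w < 2)%N -> mcoeff w (quadratic_form m) = 0.
Proof.
move=> w2; rewrite mcoeff_quadratic_form big1// => i _; rewrite big1// => j _.
by have [ijw|//] := eqP; move: w2; rewrite -ijw fdeg_letter2.
Qed.

(* An ideal generated by quadratic elements contains no new element of degree 2. *)
Lemma quadratic_ideal_low (S : set F) (Q : 'M[K]_4 -> Prop) p :
  Q 0 -> (forall m n, Q m -> Q n -> Q (m - n)) -> (forall c m, Q m -> Q (c *: m)) ->
  (forall q, S q -> exists2 m, Q m & q = quadratic_form m) ->
  generated_ideal S p ->
  Q (quadratic_part p) /\ forall w : word, (fdeg w < 2)%N -> mcoeff w p = 0.
Proof.
move=> Q0 QB QZ SQ Sp.
apply: (Sp [set q | Q (quadratic_part q) /\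
                    forall w : word, (fdeg w < 2)%N -> mcoeff w q = 0]).
split; last first.
  by move=> q /SQ[m Qm ->] /=; rewrite quadratic_formK; split => // w; exact: quadratic_form_low.
split => /=.
- by rewrite linear0; split => // w _; rewrite mcoeff0.
- move=> q r [Qq q0] [Qr r0]; rewrite linearB; split => [|w w2]; first exact: QB.
  by rewrite mcoeffB q0// r0// subrr.
- move=> a q [Qq q0]; split => [|w w2]; last first.
    by rewrite mcoeff_low_order_mull ?q0 ?mulr0// ltnW.
  have -> : quadratic_part (a * q) = mcoeff mone a *: quadratic_part q.
    by apply/matrixP => i j; rewrite !mxE mcoeff_low_order_mull// fdeg_letter2.
  exact: QZ.
- move=> a q [Qq q0]; split => [|w w2]; last first.
    by rewrite mcoeff_low_order_mulr ?q0 ?mul0r// ltnW.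
  have -> : quadratic_part (q * a) = mcoeff mone a *: quadratic_part q.
    by apply/matrixP => i j; rewrite !mxE mcoeff_low_order_mulr ?fdeg_letter2// mulrC.
  exact: QZ.
Qed.

Lemma quadratic_form_delta (i j : 'I_4) :
  quadratic_form (delta_mx i j) = free_gen K i * free_gen K j.
Proof.
transitivity (\sum_(k | k == i) \sum_(l | l == j) free_gen K k * free_gen K l).
  rewrite /quadratic_form [RHS]big_mkcond; apply: eq_bigr => k _.
  have [ki|ki] := eqVneq k i.
    rewrite [RHS]big_mkcond; apply: eq_bigr => l _; rewrite mxE ki eqxx andTb.
    by have [lj|lj] := eqVneq l j; rewrite ?scale1r ?scale0r.
  by rewrite big1// => l _; rewrite mxE (negbTE ki) andFb scale0r.
by rewrite !big_pred1_eq.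
Qed.

Lemma quadratic_form_relation (a b : K) (i j l m : 'I_4) :
  quadratic_form (a *: (delta_mx i j - delta_mx j i) -
                  b *: (delta_mx l m + delta_mx m l)) =
  a *: comm_minus (free_gen K i) (free_gen K j) -
  b *: comm_plus (free_gen K l) (free_gen K m).
Proof.
rewrite raddfB /=; congr (_ - _); rewrite linearZ_LR; congr (_ *: _).
  by rewrite raddfB /= !quadratic_form_delta.
by rewrite raddfD /= !quadratic_form_delta.
Qed.

Lemma free_graded1 (p : F) : @free_graded K 1 p ->
  p = \sum_i mcoeff (fmu i : word) p *: free_gen K i.
Proof.
move=> p1; apply/malgP => w; rewrite raddf_sum/=.
under eq_bigr do rewrite mcoeffZ mcoeffU mulr_natr.
have [w1|w1] := eqVneq (fdeg w) 1%N; last first.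
  rewrite big1 => [|i _]; first by apply/eqP; apply: contraNT w1 => /p1 /eqP.
  by have [iw|//] := eqP; rewrite -iw fdegU in w1.
have [i wi] : exists i, w = fmu i.
  case: w w1 => -[|i []]//= _; exists i; by rewrite fmuE.
rewrite wi (bigD1 i)//= eqxx mulr1n big1 ?addr0// => j ji.
by rewrite fmP !fmU eqseq_cons (negbTE ji).
Qed.

Lemma free_gen_graded i : @free_graded K 1 (free_gen K i).
Proof.
move=> w; rewrite mcoeffU; case: (fmu i =P w) => [<- _|_]; first by rewrite fdegU.
by rewrite eqxx.
Qed.
End FreeAlgebraWords.

(** * Graded isomorphisms as invertible matrices *)

Section GradedMorphism.
Variable K : fieldType.
Local Notation F := (free_algebra K).

Definition linear_form (c : 'rV[K]_4) : F := \sum_i c ord0 i *: free_gen K i.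

Lemma linear_formM (a b : 'rV[K]_4) :
  linear_form a * linear_form b = quadratic_form (a^T *m b).
Proof.
rewrite /linear_form /quadratic_form mulr_suml; apply: eq_bigr => i _.
rewrite mulr_sumr; apply: eq_bigr => j _.
by rewrite mxE big_ord1 !mxE -scalerAl -scalerAr scalerA.
Qed.

Lemma mcoeff_linear_form (c : 'rV[K]_4) j : mcoeff (fmu j) (linear_form c) = c ord0 j.
Proof.
rewrite /linear_form raddf_sum.
transitivity (\sum_(i | i == j) c ord0 i); last by rewrite big_pred1_eq.
rewrite [RHS]big_mkcond; apply: eq_bigr => i _; rewrite [LHS]mcoeffZ mcoeffU.
by rewrite fmP !fmU eqseq_cons andbT mulr_natr; case: (i == j).
Qed.

Lemma linear_form0 : linear_form 0 = 0.
Proof. by rewrite /linear_form big1// => i _; rewrite mxE scale0r. Qed.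

Lemma linear_form_mulmx (c : 'rV[K]_4) (T : 'M[K]_4) :
  \sum_i c ord0 i *: linear_form (row i T) = linear_form (c *m T).
Proof.
transitivity (\sum_i \sum_j c ord0 i *: (row i T ord0 j *: free_gen K j)).
  by apply: eq_bigr => i _; rewrite scaler_sumr.
rewrite exchange_big; apply: eq_bigr => j _; rewrite mxE scaler_suml.
by apply: eq_bigr => i _; rewrite mxE scalerA.
Qed.

Lemma quadratic_form_change (r T : 'M[K]_4) :
  \sum_i \sum_j r i j *: (linear_form (row i T) * linear_form (row j T)) =
  quadratic_form (T^T *m r *m T).
Proof.
have -> : T^T *m r *m T = \sum_i \sum_j r i j *: ((row i T)^T *m row j T).
  apply/matrixP => a b; rewrite mxE summxE.
  under eq_bigr do rewrite mxE mulr_suml.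
  rewrite exchange_big; apply: eq_bigr => i _; rewrite summxE.
  apply: eq_bigr => j _; rewrite !mxE big_ord1 !mxE; ring.
rewrite raddf_sum; apply: eq_bigr => i _; rewrite raddf_sum; apply: eq_bigr => j _.
by rewrite /= linearZ_LR linear_formM.
Qed.

Lemma unitmx_row_inj n (T : 'M[K]_n) :
  (forall c : 'rV_n, c *m T = 0 -> c = 0) -> T \in unitmx.
Proof.
move=> T0; rewrite -row_free_unit -kermx_eq0; apply/eqP/row_matrixP => i.
by rewrite row0; apply: T0; rewrite -row_mul mulmx_ker row0.
Qed.

Variables I J : Defs.proper_ideal F.
Hypothesis I_low : forall p, ideal_set I p ->
  forall w : fmonom 'I_4, (fdeg w < 2)%N -> mcoeff w p = 0.
Local Notation piI := (quot_pi I).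
Local Notation piJ := (quot_pi J).

Lemma quot_pi_eq0 (L : Defs.proper_ideal F) p : quot_pi L p = 0 <-> ideal_set L p.
Proof. by rewrite -(raddf0 (quot_pi L)) quot_piP subr0. Qed.

(** Degree 1 is preserved, so each generator goes to the class of a linear form, whose coefficients
    are a row of [T]. A vector in the left kernel of [T] gives a linear form lying in [I], and
    [I_low] makes it zero; hence [T] is invertible. *)
Lemma graded_morphism_matrix (f : {lrmorphism quotient_algebra I -> quotient_algebra J}) :
  injective f ->
  (forall n, f @` (piI @` @free_graded K n) = piJ @` @free_graded K n) ->
  exists2 T : 'M[K]_4, T \in unitmx &
    forall r, ideal_set I (quadratic_form r) <->
              ideal_set J (quadratic_form (T^T *m r *m T)).
Proof.
move=> finj fgr.
have /choice[t tP] i : exists c : 'rV[K]_4,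
    f (piI (free_gen K i)) = piJ (linear_form c).
  have : (piJ @` @free_graded K 1) (f (piI (free_gen K i))).
    rewrite -fgr; exists (piI (free_gen K i)) => //; exists (free_gen K i) => //.
    exact: free_gen_graded.
  move=> [p /free_graded1 pE <-]; exists (\row_j mcoeff (fmu j) p).
  by congr piJ; rewrite {1}pE; apply: eq_bigr => j _; rewrite mxE.
pose T : 'M[K]_4 := \matrix_(i, j) t i ord0 j.
have rT i : row i T = t i by apply/rowP => j; rewrite !mxE.
exists T.
  apply: unitmx_row_inj => c cT.
  have : ideal_set I (linear_form c).
    apply/quot_pi_eq0; apply: finj; rewrite raddf0 /linear_form raddf_sum/= raddf_sum/=.
    under eq_bigr => i _ do rewrite linearZ_LR /= linearZ_LR /= tP -linearZ_LR /=.
    rewrite -raddf_sum/= -(raddf0 piJ); congr (piJ _).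
    under eq_bigr => i _ do rewrite -rT.
    by rewrite linear_form_mulmx cT linear_form0.
  move=> /I_low cI; apply/rowP => j; rewrite mxE -mcoeff_linear_form cI//.
  by rewrite fdegU.
move=> r; rewrite -!quot_pi_eq0 -quadratic_form_change.
have -> : piI (quadratic_form r) = 0 <-> f (piI (quadratic_form r)) = 0.
  split=> [->|h]; first exact: raddf0.
  by apply: finj; rewrite h raddf0.
suff -> : f (piI (quadratic_form r)) =
  piJ (\sum_i \sum_j r i j *: (linear_form (row i T) * linear_form (row j T))) by [].
rewrite /quadratic_form !raddf_sum/=; apply: eq_bigr => i _.
rewrite !raddf_sum/=; apply: eq_bigr => j _.
by rewrite !quot_piZ !quot_piM linearZ_LR rmorphM /= !tP !rT.
Qed.
End GradedMorphism.

(** * Isomorphisms induced by rescaling the generators *)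

Section DiagonalScaling.
Variable K : fieldType.
Local Notation F := (free_algebra K).
Local Notation word := (fmonom 'I_4).
Implicit Types (lam mu : 'I_4 -> K).

Definition word_weight lam (w : word) : K := \prod_(i <- (w : seq 'I_4)) lam i.

Lemma word_weightM lam v w : word_weight lam (mmul v w) = word_weight lam v * word_weight lam w.
Proof. by rewrite /word_weight fmM big_cat. Qed.

(** The endomorphism x^i -> lam_i x^i, written on the basis of words so that it acts diagonally on
    coefficients. *)
Definition rescale lam (p : F) : F :=
  \sum_(w <- msupp p) mkmalgU w (word_weight lam w * mcoeff w p).

Lemma mcoeff_rescale lam p w : mcoeff w (rescale lam p) = word_weight lam w * mcoeff w p.
Proof.
transitivity (\sum_(v <- msupp p) (word_weight lam v * mcoeff v p) *+ (v == w)).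
  by rewrite /rescale raddf_sum; apply: eq_bigr => v _; exact: mcoeffU.
rewrite [in RHS](monalgE p) raddf_sum mulr_sumr; apply: eq_bigr => v _.
rewrite [X in _ = _ * X]mcoeffU.
by case: (v =P w) => [->|_]; rewrite ?mulr0n ?mulr0.
Qed.

Lemma rescale_is_zmod_morphism lam : zmod_morphism (rescale lam).
Proof.
move=> p q; apply/malgP => w; rewrite [LHS]mcoeff_rescale [in LHS]mcoeffB.
by rewrite [RHS]mcoeffB [X in _ = X - _]mcoeff_rescale [X in _ = _ - X]mcoeff_rescale mulrBr.
Qed.
HB.instance Definition _ lam := GRing.isZmodMorphism.Build F F (rescale lam)
  (rescale_is_zmod_morphism lam).

Lemma rescale_is_scalable lam : scalable (rescale lam).
Proof.
move=> c p; apply/malgP => w; rewrite [LHS]mcoeff_rescale [in LHS]mcoeffZ.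
by rewrite [RHS](mcoeffZ c (rescale lam p) w) mcoeff_rescale; exact: mulrCA.
Qed.
HB.instance Definition _ lam := GRing.isScalable.Build K F F *:%R (rescale lam)
  (rescale_is_scalable lam).

Lemma msupp_rescale lam p : fsubset (msupp (rescale lam p)) (msupp p).
Proof.
apply/fsubsetP => w; rewrite -!mcoeff_neq0 mcoeff_rescale.
by apply: contraNN => /eqP ->; rewrite mulr0.
Qed.

Lemma rescale_is_monoid_morphism lam : monoid_morphism (rescale lam).
Proof.
split=> [|p q]; apply/malgP => w.
  rewrite [LHS]mcoeff_rescale !mcoeff1; have [->|_] := eqP; last by rewrite mulr0.
  by rewrite mulr1 /word_weight fm1 big_nil.
rewrite [LHS]mcoeff_rescale [RHS](mcoeffMlw w (msupp_rescale lam p) (msupp_rescale lam q)).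
rewrite [in LHS]mcoeffMl mulr_sumr; apply: eq_bigr => v _; rewrite mulr_sumr.
apply: eq_bigr => v' _; rewrite (mcoeff_rescale lam p v) (mcoeff_rescale lam q v') mulrnAr.
have [<-|//] := eqP; rewrite !mulr1n word_weightM; ring.
Qed.
HB.instance Definition _ lam := GRing.isMonoidMorphism.Build F F (rescale lam)
  (rescale_is_monoid_morphism lam).

Lemma rescaleK lam mu : (forall i, mu i * lam i = 1) -> cancel (rescale lam) (rescale mu).
Proof.
move=> ml p; apply/malgP => w; rewrite [LHS]mcoeff_rescale mcoeff_rescale mulrA /word_weight -big_split/=.
by rewrite big1 ?mul1r.
Qed.

Lemma rescale_graded lam n p : @free_graded K n p -> @free_graded K n (rescale lam p).
Proof.
by move=> pn w; rewrite mcoeff_rescale mulf_eq0 negb_or => /andP[_]; exact: pn.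
Qed.

Lemma rescale_free_gen lam i : rescale lam (free_gen K i) = lam i *: free_gen K i.
Proof.
apply/malgP => w; rewrite [LHS]mcoeff_rescale [RHS]mcoeffZ /free_gen mcoeffU.
by case: (fmu i =P w) => [<-|_]; rewrite ?mulr0n ?mulr0// /word_weight fmU big_seq1.
Qed.

Lemma rescale_relation lam (a b : K) i j l m :
  rescale lam (a *: comm_minus (free_gen K i) (free_gen K j) -
               b *: comm_plus (free_gen K l) (free_gen K m)) =
  (lam i * lam j * a) *: comm_minus (free_gen K i) (free_gen K j) -
  (lam l * lam m * b) *: comm_plus (free_gen K l) (free_gen K m).
Proof.
rewrite (lrmorphism_relation (rescale lam)) /= !rescale_free_gen comm_minusZ comm_plusZ.
by rewrite !scalerA [a * _]mulrC [b * _]mulrC.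
Qed.

(** The preimage of [J] under [rescale lam] is a two-sided ideal, so it contains the ideal generated
    by [S] once it contains [S]. *)
Lemma rescale_ideal lam (S : set F) (J : Defs.proper_ideal F) :
  (forall p, S p -> ideal_set J (rescale lam p)) ->
  forall p, generated_ideal S p -> ideal_set J (rescale lam p).
Proof.
move=> SJ p Sp; apply: (Sp [set q | ideal_set J (rescale lam q)]).
have [J0 JB JMl JMr] := ideal_two_sided J.
split; last exact: SJ.
split.
- by rewrite /= raddf0.
- by move=> a b aJ bJ; rewrite /= (raddfB (rescale lam) a b); exact: JB.
- by move=> a b bJ; rewrite /= (rmorphM (rescale lam) a b); exact: JMl.
- by move=> a b bJ; rewrite /= (rmorphM (rescale lam) b a); exact: JMr.
Qed.

Section Induced.
Variables (I J : Defs.proper_ideal F) (lam : 'I_4 -> K).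
Hypothesis IJ : forall p, ideal_set I p -> ideal_set J (rescale lam p).

Definition rescale_quotient (x : quotient_algebra I) : quotient_algebra J :=
  quot_pi J (rescale lam (quot_repr x)).

Lemma rescale_quotient_pi p :
  rescale_quotient (quot_pi I p) = quot_pi J (rescale lam p).
Proof.
by apply/quot_piP; rewrite -raddfB; apply: IJ; exact: quot_repr_pi.
Qed.

Lemma rescale_quotient_lrmorphism :
  exists f : {lrmorphism quotient_algebra I -> quotient_algebra J}, f =1 rescale_quotient.
Proof.
have fB : zmod_morphism rescale_quotient.
  elim/quot_ind=> p; elim/quot_ind=> q.
  by rewrite -raddfB !rescale_quotient_pi -raddfB -raddfB.
have fM : monoid_morphism rescale_quotient.
  split; first by rewrite -[1]/(quot_pi I 1) rescale_quotient_pi rmorph1.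
  elim/quot_ind=> p; elim/quot_ind=> q.
  by rewrite -quot_piM !rescale_quotient_pi rmorphM quot_piM.
have fZ : scalable rescale_quotient.
  move=> c; elim/quot_ind=> p.
  by rewrite -quot_piZ rescale_quotient_pi linearZ_LR quot_piZ rescale_quotient_pi.
pose fb := GRing.isZmodMorphism.Build _ _ rescale_quotient fB.
pose fm := GRing.isMonoidMorphism.Build _ _ rescale_quotient fM.
pose fz := GRing.isScalable.Build _ _ _ _ rescale_quotient fZ.
pose f : {lrmorphism quotient_algebra I -> quotient_algebra J} :=
  HB.pack rescale_quotient fb fm fz.
by exists f.
Qed.
End Induced.

Lemma rescale_graded_isomorphism (I J : Defs.proper_ideal F) lam :
  (forall i, lam i != 0) ->
  (forall p, ideal_set I p -> ideal_set J (rescale lam p)) ->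
  (forall p, ideal_set J p -> ideal_set I (rescale (fun i => (lam i)^-1) p)) ->
  exists f : {lrmorphism quotient_algebra I -> quotient_algebra J},
    bijective f /\
    forall n, f @` (quot_pi I @` @free_graded K n) = quot_pi J @` @free_graded K n.
Proof.
move=> lam0 IJ JI; have [f fE] := rescale_quotient_lrmorphism IJ; exists f.
have lK : cancel (rescale lam) (rescale (fun i => (lam i)^-1)).
  by apply: rescaleK => i; rewrite mulVf.
have lK' : cancel (rescale (fun i => (lam i)^-1)) (rescale lam).
  by apply: rescaleK => i; rewrite mulfV.
split.
  exists (rescale_quotient (I := J) I (fun i => (lam i)^-1)).
    by elim/quot_ind=> p; rewrite fE !rescale_quotient_pi// lK.
  by elim/quot_ind=> p; rewrite fE !rescale_quotient_pi// lK'.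
move=> n; apply/seteqP; split => y [].
  move=> _ [p pn <-] <-; exists (rescale lam p); first exact: rescale_graded.
  by rewrite fE rescale_quotient_pi.
move=> p pn <-; exists (quot_pi I (rescale (fun i => (lam i)^-1) p)).
  by exists (rescale (fun i => (lam i)^-1) p) => //; exact: rescale_graded.
by rewrite fE rescale_quotient_pi// lK'.
Qed.
End DiagonalScaling.

(** * The relations as a matrix space, and diagonal isomorphisms *)

Section RelationSpace.
Variable R : realType.
Local Notation C := R[i].
Local Notation "a %:C" := (real_complex R a).
Implicit Types (phi psi : 'rV[R]_3).

(* phi_0 := 0 makes the relations symmetric under permutations of the four
   generators. *)
Definition angle phi (i : 'I_4) : R :=
  if unlift ord0 i is Some k then phi ord0 k else 0.
Definition sind phi i j := sin (angle phi i - angle phi j).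
Definition cosd phi i j := cos (angle phi i - angle phi j).

(* The antisymmetric matrix with entries alpha_k at (0, k) and beta_k at (l, m);
   exchanging alpha and beta is the Hodge star. *)
Definition hodge (alpha beta : 'I_3 -> C) (i j : 'I_4) : C :=
  match nat_of_ord i, nat_of_ord j with
  | 0, 1 => alpha 0 | 0, 2 => alpha 1 | 0, 3 => alpha 2%:R
  | 1, 0 => - alpha 0 | 2, 0 => - alpha 1 | 3, 0 => - alpha 2%:R
  | 2, 3 => beta 0 | 3, 1 => beta 1 | 1, 2 => beta 2%:R
  | 3, 2 => - beta 0 | 1, 3 => - beta 1 | 2, 1 => - beta 2%:R
  | _, _ => 0
  end.

(** [hodge] and [sind] are odd and [cosd] is even under exchange of the indices, so the first term
    is the antisymmetric part and the second the symmetric part. [alpha k] is the coefficient of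
    [relation1 phi k] and [beta k] that of [relation2 phi k]. *)
Definition relation_mx phi (alpha beta : 'I_3 -> C) : 'M[C]_4 :=
  \matrix_(i, j) (hodge alpha beta i j * (cosd phi i j)%:C
                  - 'i%C * hodge beta alpha i j * (sind phi i j)%:C).

Definition relation_space phi (m : 'M[C]_4) : Prop :=
  exists alpha beta, m = relation_mx phi alpha beta.

Lemma ord4P (P : 'I_4 -> Prop) :
  P ord0 -> P (lift ord0 (0 : 'I_3)) -> P (lift ord0 (1 : 'I_3)) ->
  P (lift ord0 (2%:R : 'I_3)) -> forall i, P i.
Proof.
move=> p0 p1 p2 p3 i; case: (unliftP ord0 i) => [k ->|->//].
by case: k => -[|[|[|//]]] k3; [move: p1|move: p2|move: p3];
  congr (P (lift _ _)); apply: val_inj.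
Qed.

(** The star exchanges complementary pairs of indices; [e] is the sign of the permutation, found by
    enumeration. *)
Lemma hodge_dual (i j l m : 'I_4) : uniq [:: i; j; l; m] ->
  exists2 e : C, e ^+ 2 = 1 &
  forall alpha beta, hodge beta alpha l m = e * hodge alpha beta i j.
Proof.
by case: i j l m => -[|[|[|[|//]]]] ? [[|[|[|[|//]]]] ?] [[|[|[|[|//]]]] ?]
  [[|[|[|[|//]]]] ?] //= _;
  first [by exists 1 => [|a b]; rewrite ?expr1n// /hodge/= mul1r
        |by exists (-1) => [|a b]; rewrite ?sqrrN ?expr1n// /hodge/= mulN1r ?opprK].
Qed.

Lemma hodge_antisymmetric (f : 'I_4 -> 'I_4 -> C) : (forall i j, f i j = - f j i) ->
  exists alpha beta, forall i j, hodge alpha beta i j = f i j.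
Proof.
move=> fN; pose x (k : 'I_3) : 'I_4 := lift ord0 k.
exists (fun k => f ord0 (x k)), (fun k => f (x (k + 1)) (x (k + 2%:R))) => i j.
have f0 k : f k k = 0.
  by have /eqP := fN k k; rewrite -addr_eq0 -mulr2n mulrn_eq0 => /eqP.
by elim/ord4P: i; elim/ord4P: j; rewrite /hodge/= ?f0// -?fN;
  congr f; apply: val_inj.
Qed.

Lemma hodgeC alpha beta i j : hodge alpha beta j i = - hodge alpha beta i j.
Proof.
by case: i j => -[|[|[|[|//]]]] ? [[|[|[|[|//]]]] ?]; rewrite /hodge/= ?oppr0 ?opprK.
Qed.

Lemma sindC phi i j : sind phi j i = - sind phi i j.
Proof. by rewrite /sind -sinN opprB. Qed.

Lemma cosdC phi i j : cosd phi j i = cosd phi i j.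
Proof. by rewrite /cosd -cosN opprB. Qed.

Lemma angle0 phi : angle phi ord0 = 0.
Proof. by rewrite /angle unlift_none. Qed.

Lemma angleS phi k : angle phi (lift ord0 k) = phi ord0 k.
Proof. by rewrite /angle liftK. Qed.

Lemma relation_mx_antisym phi alpha beta i j :
  relation_mx phi alpha beta i j - relation_mx phi alpha beta j i =
  2 * hodge alpha beta i j * (cosd phi i j)%:C.
Proof.
rewrite !mxE (hodgeC _ _ i j) (hodgeC _ _ i j) (sindC _ i j) (cosdC _ i j) rmorphN/=.
ring.
Qed.

Lemma relation_mx_sym phi alpha beta i j :
  relation_mx phi alpha beta i j + relation_mx phi alpha beta j i =
  - (2 * 'i%C * hodge beta alpha i j * (sind phi i j)%:C).
Proof.
rewrite !mxE (hodgeC _ _ i j) (hodgeC _ _ i j) (sindC _ i j) (cosdC _ i j) rmorphN/=.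
ring.
Qed.

Lemma hodge_is_linear c alpha beta alpha' beta' i j :
  hodge (fun k => c * alpha k + alpha' k) (fun k => c * beta k + beta' k) i j =
  c * hodge alpha beta i j + hodge alpha' beta' i j.
Proof.
case: i j => -[|[|[|[|//]]]] ? [[|[|[|[|//]]]] ?]; rewrite /hodge/=.
all: ring.
Qed.

Lemma relation_space_linear phi c m n : relation_space phi m ->
  relation_space phi n -> relation_space phi (c *: m + n).
Proof.
move=> [a [b ->]] [a' [b' ->]].
exists (fun k => c * a k + a' k), (fun k => c * b k + b' k).
apply/matrixP => i j; rewrite !mxE !hodge_is_linear; ring.
Qed.

Lemma relation_space0 phi : relation_space phi 0.
Proof.
exists (fun=> 0), (fun=> 0); apply/matrixP => i j; rewrite !mxE.
have -> : hodge (fun=> 0) (fun=> 0) i j = 0.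
  by case: i j => -[|[|[|[|//]]]] ? [[|[|[|[|//]]]] ?]; rewrite /hodge/= ?oppr0.
by rewrite mulr0 !mul0r subrr.
Qed.

Lemma sum_ord3 (V : zmodType) (f : 'I_3 -> V) : \sum_k f k = f 0 + f 1 + f 2%:R.
Proof.
by rewrite !big_ord_recl big_ord0 addr0 addrA; congr (_ + f _ + f _); apply: val_inj.
Qed.

Let x (k : 'I_3) : 'I_4 := lift ord0 k.

Definition relation1_mx phi k : 'M[C]_4 :=
  (cos (phi ord0 k))%:C *: (delta_mx ord0 (x k) - delta_mx (x k) ord0) -
  ('i%C * (sin (phi ord0 (k + 1) - phi ord0 (k + 2%:R)))%:C) *:
    (delta_mx (x (k + 1)) (x (k + 2%:R)) + delta_mx (x (k + 2%:R)) (x (k + 1))).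

Definition relation2_mx phi k : 'M[C]_4 :=
  (cos (phi ord0 (k + 1) - phi ord0 (k + 2%:R)))%:C *:
    (delta_mx (x (k + 1)) (x (k + 2%:R)) - delta_mx (x (k + 2%:R)) (x (k + 1))) -
  (- 'i%C * (sin (phi ord0 k))%:C) *: (delta_mx ord0 (x k) + delta_mx (x k) ord0).

Lemma relation1E phi k : relation1 phi k = quadratic_form (relation1_mx phi k).
Proof. by rewrite /relation1_mx quadratic_form_relation. Qed.

Lemma relation2E phi k : relation2 phi k = quadratic_form (relation2_mx phi k).
Proof. by rewrite /relation2_mx quadratic_form_relation. Qed.

Lemma delta_antisym_hodge1 k i j :
  (delta_mx ord0 (x k) - delta_mx (x k) ord0 : 'M[C]_4) i j =
  hodge (fun l => (l == k)%:R) (fun=> 0) i j.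
Proof.
rewrite 4!mxE; case: k => -[|[|[|//]]] ?;
by case: i j => -[|[|[|[|//]]]] ? [[|[|[|[|//]]]] ?]; rewrite /hodge/= ?subr0 ?sub0r ?oppr0.
Qed.

Lemma delta_antisym_hodge2 k i j :
  (delta_mx (x (k + 1)) (x (k + 2%:R)) - delta_mx (x (k + 2%:R)) (x (k + 1)) : 'M[C]_4) i j =
  hodge (fun=> 0) (fun l => (l == k)%:R) i j.
Proof.
rewrite 4!mxE; case: k => -[|[|[|//]]] ?;
by case: i j => -[|[|[|[|//]]]] ? [[|[|[|[|//]]]] ?]; rewrite /hodge/= ?subr0 ?sub0r ?oppr0.
Qed.

Lemma mxEB (A B : 'M[C]_4) i j : (A - B) i j = A i j - B i j.
Proof. by rewrite !mxE. Qed.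

Lemma mxED (A B : 'M[C]_4) i j : (A + B) i j = A i j + B i j.
Proof. by rewrite !mxE. Qed.

Lemma delta_mxM (f : 'I_4 -> 'I_4 -> C) (a b i j : 'I_4) :
  (delta_mx a b : 'M[C]_4) i j * f a b = (delta_mx a b : 'M[C]_4) i j * f i j.
Proof.
by rewrite mxE; have [->|] := eqVneq i a; have [->|] := eqVneq j b; rewrite ?mul0r.
Qed.

Lemma delta_cosd phi (a b i j : 'I_4) :
  (delta_mx a b - delta_mx b a : 'M[C]_4) i j * (cosd phi a b)%:C =
  (delta_mx a b - delta_mx b a : 'M[C]_4) i j * (cosd phi i j)%:C.
Proof.
pose f p q := (cosd phi p q)%:C.
rewrite mxEB [LHS]mulrBl [RHS]mulrBl (delta_mxM f a b); congr (_ - _).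
by rewrite -(delta_mxM f b a) /f cosdC.
Qed.

Lemma delta_sind phi (a b i j : 'I_4) :
  (delta_mx a b + delta_mx b a : 'M[C]_4) i j * (sind phi a b)%:C =
  (delta_mx a b - delta_mx b a : 'M[C]_4) i j * (sind phi i j)%:C.
Proof.
pose f p q := (sind phi p q)%:C.
rewrite mxEB mxED [LHS]mulrDl [RHS]mulrBl (delta_mxM f a b); congr (_ + _).
by rewrite -(delta_mxM f b a) /f sindC rmorphN mulrN.
Qed.

Lemma relation1_mxE phi k :
  relation1_mx phi k = relation_mx phi (fun l => (l == k)%:R) (fun=> 0).
Proof.
apply/matrixP => i j; rewrite [RHS]mxE -delta_antisym_hodge1 -delta_antisym_hodge2.
rewrite -mulrA -delta_cosd -delta_sind /relation1_mx.
have -> : cosd phi ord0 (x k) = cos (phi ord0 k) by rewrite /cosd angle0 angleS sub0r cosN.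
have -> : sind phi (x (k + 1)) (x (k + 2%:R)) = sin (phi ord0 (k + 1) - phi ord0 (k + 2%:R)).
  by rewrite /sind !angleS.
rewrite mxEB; congr (_ - _); rewrite mxE; first exact: mulrC.
by rewrite -mulrA; congr (_ * _); exact: mulrC.
Qed.

Lemma relation2_mxE phi k :
  relation2_mx phi k = relation_mx phi (fun=> 0) (fun l => (l == k)%:R).
Proof.
apply/matrixP => i j; rewrite [RHS]mxE -delta_antisym_hodge1 -delta_antisym_hodge2.
rewrite -mulrA -delta_cosd -delta_sind /relation2_mx.
have -> : sind phi ord0 (x k) = - sin (phi ord0 k) by rewrite /sind angle0 angleS sub0r sinN.
have -> : cosd phi (x (k + 1)) (x (k + 2%:R)) = cos (phi ord0 (k + 1) - phi ord0 (k + 2%:R)).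
  by rewrite /cosd !angleS.
rewrite mxEB; congr (_ - _); rewrite mxE; first exact: mulrC.
by rewrite rmorphN/= !mulNr !mulrN -mulrA; congr (- (_ * _)); exact: mulrC.
Qed.

Lemma relation_mx_linear phi c alpha beta alpha' beta' :
  c *: relation_mx phi alpha beta + relation_mx phi alpha' beta' =
  relation_mx phi (fun k => c * alpha k + alpha' k) (fun k => c * beta k + beta' k).
Proof. by apply/matrixP => i j; rewrite !mxE !hodge_is_linear; ring. Qed.

Lemma relation_mxE phi alpha beta : relation_mx phi alpha beta =
  \sum_k (alpha k *: relation1_mx phi k + beta k *: relation2_mx phi k).
Proof.
rewrite sum_ord3 -[RHS]addr0 -!addrA !relation1_mxE !relation2_mxE.
have -> : 0 = relation_mx phi (fun=> 0) (fun=> 0).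
  have h := relation_mx_linear phi (-1) (fun=> 0) (fun=> 0) (fun=> 0) (fun=> 0).
  rewrite scaleN1r addNr in h; rewrite [LHS]h.
  by congr relation_mx; apply/funext => k; rewrite mulr0 addr0.
rewrite !relation_mx_linear; congr relation_mx; apply/funext;
  by case => -[|[|[|//]]] k3; rewrite /= !(mulr0, add0r, addr0, mulr1);
     congr (_ _); apply: val_inj.
Qed.

(** Another lift of the same point has the same sines and cosines of angles and of their
    differences, so a fixed lift [phi] can be used. *)
Lemma quadratic_relationsP phi q : quadratic_relations (torus_point phi) q ->
  exists k, q = relation1 phi k \/ q = relation2 phi k.
Proof.
move=> [psi phipsi [k qk]].
have cE j : cos (psi ord0 j) = cos (phi ord0 j).
  by move/rowP : phipsi => /(_ j); rewrite !mxE => -[].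
have sE j : sin (psi ord0 j) = sin (phi ord0 j).
  by move/rowP : phipsi => /(_ j); rewrite !mxE => -[].
have cdE j l : cos (psi ord0 j - psi ord0 l) = cos (phi ord0 j - phi ord0 l).
  by rewrite !cosB !cE !sE.
have sdE j l : sin (psi ord0 j - psi ord0 l) = sin (phi ord0 j - phi ord0 l).
  by rewrite !sinB !cE !sE.
have e1 : relation1_mx psi k = relation1_mx phi k by rewrite /relation1_mx (cE k) (sdE (k + 1) (k + 2%:R)).
have e2 : relation2_mx psi k = relation2_mx phi k.
  rewrite /relation2_mx (cdE (k + 1) (k + 2%:R)); have sk := sE k; rewrite sk.
  reflexivity.
exists k; case: qk => ->; [left|right].
- exact: etrans (relation1E psi k) (etrans (congr1 _ e1) (esym (relation1E phi k))).
- exact: etrans (relation2E psi k) (etrans (congr1 _ e2) (esym (relation2E phi k))).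
Qed.

Lemma quadratic_relationsE phi q : quadratic_relations (torus_point phi) q ->
  exists2 m, relation_space phi m & q = quadratic_form m.
Proof.
move=> /quadratic_relationsP[k []->]; [exists (relation1_mx phi k)|exists (relation2_mx phi k)].
- by rewrite relation1_mxE; do 2!eexists; reflexivity.
- exact: relation1E.
- by rewrite relation2_mxE; do 2!eexists; reflexivity.
- exact: relation2E.
Qed.

Lemma relation_ideal_low phi p :
  generated_ideal (quadratic_relations (torus_point phi)) p ->
  relation_space phi (quadratic_part p) /\
  forall w : fmonom 'I_4, (fdeg w < 2)%N -> mcoeff w p = 0.
Proof.
apply: quadratic_ideal_low.
- exact: relation_space0.
- move=> m n mS nS; rewrite addrC -scaleN1r; exact: relation_space_linear.
- move=> c m mS; rewrite -[_ *: _]addr0; apply: relation_space_linear => //.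
  exact: relation_space0.
- exact: quadratic_relationsE.
Qed.

Lemma relation_space_ideal phi m : relation_space phi m <->
  generated_ideal (quadratic_relations (torus_point phi)) (quadratic_form m).
Proof.
split=> [[alpha [beta ->]]|].
  have I_ideal := generated_ideal_two_sided (quadratic_relations (torus_point phi)).
  rewrite relation_mxE raddf_sum.
  apply: (big_ind (generated_ideal (quadratic_relations (torus_point phi)))).
  - by case: I_ideal.
  - by move=> p q Ip Iq; exact: (two_sided_ideal_add I_ideal Ip Iq).
  move=> k _; rewrite raddfD /=.
  apply: (two_sided_ideal_add I_ideal); rewrite linearZ_LR;
    apply: (two_sided_ideal_scale _ I_ideal); apply: generated_ideal_sub.
    by exists phi => //; exists k; left; exact/esym/relation1E.
  by exists phi => //; exists k; right; exact/esym/relation2E.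
by move=> /relation_ideal_low[]; rewrite quadratic_formK.
Qed.

Theorem scale_equivalent_matrix psi phi :
  scale_equivalent (torus_point psi) (torus_point phi) ->
  exists2 T : 'M[C]_4, T \in unitmx &
    forall r, relation_space psi r <-> relation_space phi (T^T *m r *m T).
Proof.
move=> [f [fbij fgr]].
have [||T Tu HT] := @graded_morphism_matrix _ (relation_ideal (torus_point psi))
  (relation_ideal (torus_point phi)) _ f _ fgr.
- by move=> p /relation_ideal_low[].
- exact: bij_inj.
by exists T => // r; rewrite !relation_space_ideal; exact: HT.
Qed.

(** Within [relation1] the two coefficients may scale differently, with ratio [r k], and within
    [relation2] with the inverse ratio. This is exactly the discrepancy that a diagonal change of
    generators can absorb. *)
Definition proportional phi psi (p q r : 'I_3 -> R) := forall k : 'I_3,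
  let: l := (k + 1)%R in let: m := (k + 2%:R)%R in
  [/\ cos (psi ord0 k) = p k * cos (phi ord0 k),
      sin (psi ord0 l - psi ord0 m) = p k * r k * sin (phi ord0 l - phi ord0 m),
      cos (psi ord0 l - psi ord0 m) = q k * cos (phi ord0 l - phi ord0 m) &
      sin (psi ord0 k) = q k / r k * sin (phi ord0 k)].

(** The solution with lam_0 = 1 of the system lam_l lam_m r_k = lam_0 lam_k, for positive [r]. *)
Definition diagonal_weights (r : 'I_3 -> R) (i : 'I_4) : C :=
  if unlift ord0 i is Some k then (Num.sqrt (r (k + 1) * r (k + 2%:R)))^-1%:C else 1.

Lemma diagonal_weightsM (r : 'I_3 -> R) k : (forall k, 0 < r k) ->
  diagonal_weights r (lift ord0 (k + 1)) * diagonal_weights r (lift ord0 (k + 2%:R)) *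
  (r k)%:C = diagonal_weights r ord0 * diagonal_weights r (lift ord0 k).
Proof.
move=> r0; rewrite /diagonal_weights !liftK unlift_none mul1r -!rmorphM; congr (_ %:C).
have -> : k + 1 + 1 = k + 2%:R by rewrite -addrA.
have -> : k + 1 + 2%:R = k by rewrite -addrA -[RHS]addr0; congr (_ + _); exact: val_inj.
have -> : k + 2%:R + 1 = k by rewrite -addrA -[RHS]addr0; congr (_ + _); exact: val_inj.
have -> : k + 2%:R + 2%:R = k + 1 by rewrite -addrA; congr (_ + _); exact: val_inj.
rewrite !sqrtrM ?ltW//.
have s0 j : Num.sqrt (r j) != 0 by rewrite sqrtr_eq0 -ltNge.
rewrite -[X in _ * X = _](@sqr_sqrtr _ (r k)) ?ltW//; field; rewrite !s0//.
Qed.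

Lemma proportional_rescale phi psi p q r : (forall k, 0 < r k) ->
  proportional phi psi p q r ->
  forall a, ideal_set (relation_ideal (torus_point psi)) a ->
    ideal_set (relation_ideal (torus_point phi)) (rescale (diagonal_weights r) a).
Proof.
move=> r0 pq; apply: rescale_ideal => a /quadratic_relationsP[k ak].
have [ca sa cd sd] := pq k.
have Iphi := ideal_two_sided (relation_ideal (torus_point phi)).
have dk := diagonal_weightsM k r0.
have rk0 : (r k)%:C != 0 by rewrite fmorph_eq0; exact: lt0r_neq0.
case: ak => ->.
  have I1 : ideal_set (relation_ideal (torus_point phi)) (relation1 phi k).
    by apply: generated_ideal_sub; exists phi => //; exists k; left.
  rewrite /relation1 rescale_relation.
  apply: (two_sided_ideal_pencil (c := diagonal_weights r ord0 *
    diagonal_weights r (lift ord0 k) * (p k)%:C) Iphi _ _ I1).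
    by rewrite ca rmorphM mulrA.
  by rewrite sa !rmorphM -dk; ring.
have I2 : ideal_set (relation_ideal (torus_point phi)) (relation2 phi k).
  by apply: generated_ideal_sub; exists phi => //; exists k; right.
rewrite /relation2 rescale_relation.
apply: (two_sided_ideal_pencil (c := diagonal_weights r (lift ord0 (k + 1)) *
  diagonal_weights r (lift ord0 (k + 2%:R)) * (q k)%:C) Iphi _ _ I2).
  by rewrite cd rmorphM mulrA.
rewrite sd -dk !rmorphM fmorphV; field; exact: rk0.
Qed.

Lemma proportional_scale_equivalent phi psi p q r :
  (forall k, [/\ 0 < p k, 0 < q k & 0 < r k]) ->
  proportional phi psi p q r ->
  scale_equivalent (torus_point psi) (torus_point phi).
Proof.
move=> pqr0 pq.
have [p0 q0 r0] : [/\ forall k, 0 < p k, forall k, 0 < q k & forall k, 0 < r k].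
  by split=> k; have [] := pqr0 k.
apply: (@rescale_graded_isomorphism _ _ _ (diagonal_weights r)).
- move=> i; rewrite /diagonal_weights; case: (unlift ord0 i) => [k|]; last exact: oner_neq0.
  by rewrite fmorph_eq0 invr_neq0// sqrtr_eq0 -ltNge mulr_gt0.
- exact: proportional_rescale pq.
(* The inverse rescaling is of the same kind, with [p], [q], [r] inverted and the two points
   exchanged. *)
have -> : (fun i => (diagonal_weights r i)^-1) = diagonal_weights (fun k => (r k)^-1).
  apply/funext => i; rewrite /diagonal_weights; case: (unlift ord0 i) => [k|]; last exact: invr1.
  by rewrite -fmorphV -invfM sqrtrV ?mulr_ge0 ?ltW.
apply: (@proportional_rescale _ _ (fun k => (p k)^-1) (fun k => (q k)^-1)) => [k|k].
  by rewrite invr_gt0.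
have [ca sa cd sd] := pq k; have [pk qk rk] := pqr0 k.
rewrite ca sa cd sd; split; rewrite ?mulKf ?lt0r_neq0//.
  by field; rewrite !lt0r_neq0.
by field; rewrite !lt0r_neq0.
Qed.
End RelationSpace.

(** * Congruence of matrices with prescribed symmetry and support *)

Section DeltaTransform.
Variable K : fieldType.

Lemma mulmx_delta (T : 'M[K]_4) x y a b : (T^T *m delta_mx x y *m T) a b = T x a * T y b.
Proof.
rewrite mxE (bigD1 y)//= big1 => [|k ky].
  rewrite addr0; congr (_ * _); rewrite mxE (bigD1 x)//= big1 => [|k kx].
    by rewrite addr0 mxE mxE !eqxx mulr1.
  by rewrite mxE mxE (negbTE kx) mulr0.
rewrite mxE big1 ?mul0r// => l _.
by rewrite [X in _ * X]mxE (negbTE ky) andbF mulr0.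
Qed.

Lemma mulmx_relation (T : 'M[K]_4) c c' x y l m a b :
  (T^T *m (c *: (delta_mx x y - delta_mx y x) - c' *: (delta_mx l m + delta_mx m l)) *m T) a b =
  c * (T x a * T y b - T y a * T x b) - c' * (T l a * T m b + T m a * T l b).
Proof.
rewrite mulmxBr mulmxBl -!scalemxAr -!scalemxAl mulmxBr mulmxBl mulmxDr mulmxDl.
have eB (A B : 'M[K]_4) : (A - B) a b = A a b - B a b by rewrite !mxE.
have eD (A B : 'M[K]_4) : (A + B) a b = A a b + B a b by rewrite !mxE.
have eZ d (A : 'M[K]_4) : (d *: A) a b = d * A a b by rewrite !mxE.
by rewrite eB !eZ eB eD !mulmx_delta.
Qed.

End DeltaTransform.

Section SupportedForms.
Variable K : fieldType.
Hypothesis two_neq0 : 2 != 0 :> K.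
Variable n : nat.
Implicit Types (m T : 'M[K]_n) (E : rel 'I_n) (eps : K).

Lemma injective_image_subspace (vT : vectType K) (U W : {vspace vT}) (f : 'End(vT)) :
  lker f = 0%VS -> (U <= W)%VS -> (f @: W <= U)%VS -> (W <= U)%VS.
Proof.
move=> f0 UW fWU.
have dW : (\dim W <= \dim U)%N.
  by rewrite -(limg_dim_eq (f := f) (U := W)) ?dimvS// f0 capv0.
by have := eqEdim U W; rewrite UW dW => /eqP ->.
Qed.

Definition supported eps E m := m^T = eps *: m /\ forall i j, ~~ E i j -> m i j = 0.

(** For symmetric [E] and [eps ^+ 2 = 1] it is multiplication by 2 on the supported matrices, which
    are therefore its image. This presents them as a vector subspace with a dimension. *)
Definition symmetrize eps E m : 'M[K]_n :=
  \matrix_(i, j) (if E i j then m i j + eps * m j i else 0).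

Lemma symmetrize_is_linear eps E : linear (symmetrize eps E).
Proof.
by move=> c m m'; apply/matrixP => i j; rewrite !mxE; case: (E i j); rewrite ?mulr0 ?addr0//; ring.
Qed.
HB.instance Definition _ eps E := GRing.isLinear.Build K 'M[K]_n 'M[K]_n *:%R
  (symmetrize eps E) (symmetrize_is_linear eps E).

Definition congruence T m : 'M[K]_n := T^T *m m *m T.
Lemma congruence_is_linear T : linear (congruence T).
Proof. by move=> c m m'; rewrite /congruence mulmxDr mulmxDl -scalemxAr -scalemxAl. Qed.
HB.instance Definition _ T := GRing.isLinear.Build K 'M[K]_n 'M[K]_n *:%R
  (congruence T) (congruence_is_linear T).

Lemma supportedP eps E m : symmetric E -> eps ^+ 2 = 1 ->
  supported eps E m <-> m \in limg (linfun (symmetrize eps E)).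
Proof.
move=> Esym eps2; split=> [[mT m0]|/memv_imgP[m' _ ->]].
  apply/memv_imgP; exists (2^-1 *: m); rewrite ?memvf// lfunE /=.
  apply/matrixP => i j; rewrite !mxE.
  have := congr1 (fun M : 'M[K]_n => M i j) mT; rewrite !mxE => ->.
  have [Eij|/m0 ->//] := boolP (E i j).
  transitivity (2^-1 * (1 + eps ^+ 2) * m i j); last by ring.
  by rewrite eps2 mulVf ?mul1r// -[1 + 1]/2.
rewrite lfunE /=; split=> [|i j]; last by rewrite mxE => /negbTE ->.
apply/matrixP => i j; rewrite !mxE (Esym j i); case: (E i j); last by rewrite mulr0.
by rewrite mulrDr mulrA -expr2 eps2 mul1r addrC.
Qed.

(** Congruence by an invertible matrix embeds the space for [E] into the space for [E'], itself a
    subspace of the former since [E'] implies [E]. Equal dimensions force equality. *)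
Lemma supported_rank E E' T eps : symmetric E -> symmetric E' -> eps ^+ 2 = 1 ->
  T \in unitmx -> (forall i j, E' i j -> E i j) ->
  (forall m, supported eps E m -> supported eps E' (congruence T m)) ->
  forall m, supported eps E m -> supported eps E' m.
Proof.
move=> Es Es' eps2 Tu EE TE m; rewrite !supportedP// => mE.
apply: (subvP (injective_image_subspace (f := linfun (congruence T)) _ _ _)) mE.
- apply/eqP/lker0P => a b; rewrite !lfunE /= /congruence => h.
  have Tu' : T^T \in unitmx by rewrite unitmx_tr.
  have := congr1 (fun M => invmx T^T *m M *m invmx T) h.
  by rewrite !mulmxA mulVmx// !mul1mx -!mulmxA mulmxV// !mulmx1.
- apply/subvP => a /(supportedP _ Es' eps2)[aT a0]; apply/(supportedP _ Es eps2).
  by split => // i j Eij; apply: a0; apply: contraNN Eij; exact: EE.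
- apply/subvP => _ /memv_imgP[a aE ->]; rewrite lfunE /=.
  by apply/(supportedP _ Es' eps2); apply: TE; apply/(supportedP _ Es eps2).
Qed.
End SupportedForms.

(** * Zero patterns and tangent products under a graded isomorphism *)

Section Invariants.
Variable R : realType.
Local Notation C := R[i].
Local Notation "a %:C" := (real_complex R a).
Implicit Types (phi psi : 'rV[R]_3) (T : 'M[C]_4).

Lemma uniq4_mem (i j l m p : 'I_4) : uniq [:: i; j; l; m] -> p \in [:: i; j; l; m].
Proof.
by case: i j l m p => -[|[|[|[|//]]]] ? [[|[|[|[|//]]]] ?] [[|[|[|[|//]]]] ?]
  [[|[|[|[|//]]]] ?] [[|[|[|[|//]]]] ?].
Qed.

Lemma exists_complement (p q : 'I_4) : p != q -> exists c d, uniq [:: c; d; p; q].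
Proof.
pose o k (k4 : (k < 4)%N) := Ordinal k4.
by case: p q => -[|[|[|[|//]]]] ? [[|[|[|[|//]]]] ?] //= _;
  first [exists (o 0%N isT), (o 1%N isT); reflexivity
        |exists (o 0%N isT), (o 2%N isT); reflexivity
        |exists (o 0%N isT), (o 3%N isT); reflexivity
        |exists (o 1%N isT), (o 2%N isT); reflexivity
        |exists (o 1%N isT), (o 3%N isT); reflexivity
        |exists (o 2%N isT), (o 3%N isT); reflexivity].
Qed.

Lemma hodge_dual_sym (i j l m : 'I_4) : uniq [:: i; j; l; m] ->
  exists2 e : C, e ^+ 2 = 1 & forall alpha beta,
    hodge beta alpha l m = e * hodge alpha beta i j /\
    hodge beta alpha i j = e * hodge alpha beta l m.
Proof.
move=> u; have [e e1 eP] := hodge_dual R u; exists e => // alpha beta; split; first exact: eP.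
by rewrite (eP beta alpha) mulrA -expr2 e1 mul1r.
Qed.

(** The symmetric part at (c, d) and the antisymmetric part at (a, b) carry the same Hodge
    coefficient; eliminating it leaves an equation in the entries of [r] alone. *)
Lemma relation_space_cross phi (a b c d : 'I_4) (e : C) r :
  (forall alpha beta, hodge beta alpha c d = e * hodge alpha beta a b) ->
  relation_space phi r ->
  (r c d + r d c) * (cosd phi a b)%:C = - ('i%C * e * (sind phi c d)%:C * (r a b - r b a)).
Proof.
move=> eP [alpha [beta ->]].
by rewrite relation_mx_sym relation_mx_antisym eP; ring.
Qed.

(** A defining relation up to scalar, in a form that treats the four generators alike, so that [T]
    can be tested on any splitting into two pairs. *)
Lemma elementary_relation phi (i j l m : 'I_4) (e : C) : uniq [:: i; j; l; m] ->
  e ^+ 2 = 1 ->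
  (forall alpha beta, hodge beta alpha l m = e * hodge alpha beta i j) ->
  relation_space phi ((cosd phi i j)%:C *: (delta_mx i j - delta_mx j i) -
    ('i%C * e * (sind phi l m)%:C) *: (delta_mx l m + delta_mx m l)).
Proof.
move=> ijlm e1 eP.
pose d (x y p q : 'I_4) : C := ((p == x) && (q == y))%:R - ((p == y) && (q == x))%:R.
have dN x y p q : d x y p q = - d x y q p by rewrite /d opprB [(p == x) && _]andbC [(p == y) && _]andbC.
have d1 x y : x != y -> d x y x y = 1.
  by move=> xy; rewrite /d !eqxx (negbTE xy) subr0.
have dE x y p q : (delta_mx x y - delta_mx y x : 'M[C]_4) p q = d x y p q by rewrite mxEB !mxE.
have [alpha [beta hf]] := hodge_antisymmetric (dN i j).
(* The star of the elementary antisymmetric matrix at (i, j) is [e] times the one at (l, m): any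
   other pair has a complement different from {i, j}, where the coefficient is zero. *)
have hg p q : hodge beta alpha p q = e * d l m p q.
  have := ijlm; rewrite /= !inE !negb_or => /and4P[/and3P[ij il im] /andP[jl jm] lm _].
  have [pq|pq] := eqVneq p q.
    have hpp : hodge beta alpha p q = 0.
      have /eqP := hodgeC beta alpha p p.
      by rewrite -addr_eq0 -mulr2n mulrn_eq0 pq => /eqP.
    by rewrite hpp pq /d andbC subrr mulr0.
  have [/andP[/eqP -> /eqP ->]|plm] := boolP ((p == l) && (q == m)).
    by rewrite eP hf !d1.
  have [/andP[/eqP -> /eqP ->]|pml] := boolP ((p == m) && (q == l)).
    by rewrite hodgeC eP hf d1// (dN l m m l) d1// mulrN.
  rewrite [d l m p q]/d (negbTE plm) (negbTE pml) subrr mulr0.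
  have [a [b abpq]] := exists_complement pq.
  have [e' _ e'P] := hodge_dual R abpq; rewrite e'P hf.
  have := abpq; rewrite /= !inE !negb_or => /and4P[/and3P[ab ap aq] /andP[bp bq] _ _].
  have := uniq4_mem p ijlm; have := uniq4_mem q ijlm; rewrite !inE => qin pin.
  have nab : ~~ ((a == i) && (b == j)).
    apply/negP => /andP[/eqP ai /eqP bj]; subst a b.
    move: pin qin plm pml pq; rewrite ![p == _]eq_sym ![q == _]eq_sym.
    rewrite (negbTE ap) (negbTE bp) (negbTE aq) (negbTE bq) /=.
    by case/orP => /eqP ->; case/orP => /eqP ->; rewrite ?eqxx ?andbF.
  have nba : ~~ ((a == j) && (b == i)).
    apply/negP => /andP[/eqP ai /eqP bj]; subst a b.
    move: pin qin plm pml pq; rewrite ![p == _]eq_sym ![q == _]eq_sym.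
    rewrite (negbTE ap) (negbTE bp) (negbTE aq) (negbTE bq) /=.
    by case/orP => /eqP ->; case/orP => /eqP ->; rewrite ?eqxx ?andbF.
  by rewrite /d (negbTE nab) (negbTE nba) subrr mulr0.
exists alpha, beta; apply/matrixP => p q; rewrite [RHS]mxE hf hg.
have := delta_cosd phi i j p q; have := delta_sind phi l m p q.
rewrite !dE => h1 h2.
rewrite mxEB [in LHS]mxE [X in _ - X]mxE dE.
rewrite [_ * d i j p q]mulrC h2; congr (_ - _).
rewrite -!mulrA; congr (_ * (_ * _)); rewrite -h1; exact: mulrC.
Qed.

Section ChangeOfVariables.
Variables (psi phi : 'rV[R]_3) (T : 'M[C]_4).
Hypothesis T_unit : T \in unitmx.
Hypothesis T_rel :
  forall r, relation_space psi r <-> relation_space phi (T^T *m r *m T).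

Lemma complex_i_neq0 : 'i%C != 0 :> C.
Proof. by apply/eqP => -[/eqP]; rewrite oner_eq0. Qed.

(* Generators whose angles agree mod pi span a plane on which all the relations
   of phi vanish symmetrically; T carries it to such a plane for psi. *)
Lemma symmetric_zero a b x y : sind phi a b = 0 -> sind psi x y != 0 ->
  T x a * T y b + T y a * T x b = 0.
Proof.
move=> ab0 xy0.
have xy : x != y.
  by apply: contraNneq xy0 => ->; rewrite /sind subrr sin0.
have [l [m lmxy]] := exists_complement xy.
have [e e1 eP] := hodge_dual R lmxy.
have /T_rel[alpha [beta hr]] := elementary_relation psi lmxy e1 eP.
have := relation_mx_sym phi alpha beta a b; rewrite -hr ab0 !mulmx_relation.
set c1 := (cosd _ _ _)%:C; set c2 := _ * (sind psi x y)%:C.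
have c20 : c2 != 0.
  rewrite !mulf_neq0 ?complex_i_neq0 ?fmorph_eq0//.
  by apply/eqP => e0; move: e1; rewrite e0 expr0n/= => /eqP; rewrite eq_sym oner_eq0.
rewrite mulr0 oppr0 => h.
have /eqP : - (2 * c2) * (T x a * T y b + T y a * T x b) = 0 by rewrite -[RHS]h; ring.
by rewrite mulf_eq0 oppr_eq0 mulf_eq0 pnatr_eq0/= (negbTE c20)/= => /eqP.
Qed.

Lemma row_nonzero x : exists a, T x a != 0.
Proof.
apply: contrapT => /forallNP T0.
have : (delta_mx ord0 x : 'rV[C]_4) *m T = 0.
  rewrite -rowE; apply/rowP => a; rewrite !mxE; apply/eqP; apply: contrapT => /negP.
  exact: T0.
move=> /(congr1 (mulmx^~ (invmx T))); rewrite mulmxK// mul0mx.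
by move=> /rowP/(_ x); rewrite !mxE !eqxx => /eqP; rewrite oner_eq0.
Qed.

Lemma rows_independent x y a : x != y -> (forall b, b != a -> T x b = 0) ->
  (forall b, b != a -> T y b = 0) -> False.
Proof.
move=> xy Tx Ty.
have h : (T y a *: delta_mx ord0 x - T x a *: delta_mx ord0 y : 'rV[C]_4) *m T = 0.
  rewrite mulmxBl -!scalemxAl -!rowE; apply/rowP => b; rewrite !mxE.
  have [->|ba] := eqVneq b a; first by rewrite mulrC subrr.
  by rewrite (Tx b ba) (Ty b ba) !mulr0 subrr.
move: h => /(congr1 (mulmx^~ (invmx T))); rewrite mulmxK// mul0mx.
move=> /rowP/(_ x); rewrite !mxE !eqxx (negbTE xy) !mulr0 mulr1 subr0 => Ty0.
have [b] := row_nonzero y.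
by have [->|ba] := eqVneq b a; rewrite ?Ty0 ?Ty// eqxx.
Qed.

Definition sin_product phi (i l j m : 'I_4) := sind phi i l * sind phi j m.
Definition cos_product phi (i l j m : 'I_4) := cosd phi i l * cosd phi j m.

(* T carries the pair of relations of psi on {il|jm} to entries of the relations
   of phi on {ab|cd}: the two equations multiply to an identity between
   tan(il) tan(jm) and tan(ab) tan(cd). *)
Lemma cross_relation i l j m a b c d :
  uniq [:: i; l; j; m] -> uniq [:: a; b; c; d] ->
  T i b = 0 -> T i d = 0 -> T j b = 0 -> T j d = 0 ->
  T l a = 0 -> T l c = 0 -> T m a = 0 -> T m c = 0 ->
  T i a != 0 -> T l b != 0 ->
  T j c * T m d != 0 \/ sind psi i l != 0 /\ cosd phi c d != 0 ->
  sin_product psi i l j m * cos_product phi a b c d =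
  cos_product psi i l j m * sin_product phi a b c d.
Proof.
move=> iljm abcd Tib Tid Tjb Tjd Tla Tlc Tma Tmc Tia Tlb Tjm.
have [e e1 eP] := hodge_dual_sym iljm.
have [e' e'1 e'P] := hodge_dual_sym abcd.
have jmil : uniq [:: j; m; i; l].
  by have := rot_uniq 2 [:: i; l; j; m]; rewrite iljm.
pose X := T i a * T l b; pose Y := T j c * T m d.
pose cs (f : 'I_4 -> 'I_4 -> R) (x y : 'I_4) : C := (f x y)%:C.
have two0 : (2 * 'i%C : C) != 0 by rewrite mulf_neq0 ?pnatr_eq0 ?complex_i_neq0.
have eq1 : e * cs (sind psi) j m * Y * cs (cosd phi) a b =
           e' * cs (sind phi) c d * cs (cosd psi) i l * X.
  have /T_rel := elementary_relation psi iljm e1 (fun x y => (eP x y).1).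
  have := mulmx_relation T (cosd psi i l)%:C ('i%C * e * (sind psi j m)%:C) i l j m.
  move: (T^T *m _ *m T) => M ME /(relation_space_cross (fun x y => (e'P x y).1)).
  rewrite (ME a b) (ME b a) (ME c d) (ME d c) {ME} Tib Tid Tjb Tjd Tla Tlc Tma Tmc.
  rewrite !(mulr0, mul0r, subr0, add0r, addr0, sub0r) => h.
  apply: (mulfI two0); rewrite /X /Y /cs; apply: oppr_inj.
  by transitivity (- (2 * 'i%C * e * (sind psi j m)%:C * (T j c * T m d) * (cosd phi a b)%:C));
    [ring|apply: etrans (etrans _ h) _; ring].
have eq2 : e * cs (sind psi) i l * X * cs (cosd phi) c d =
           e' * cs (sind phi) a b * cs (cosd psi) j m * Y.
  have /T_rel := elementary_relation psi jmil e1 (fun x y => (eP x y).2).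
  have := mulmx_relation T (cosd psi j m)%:C ('i%C * e * (sind psi i l)%:C) j m i l.
  move: (T^T *m _ *m T) => M ME /(relation_space_cross (fun x y => (e'P x y).2)).
  rewrite (ME a b) (ME b a) (ME c d) (ME d c) {ME} Tib Tid Tjb Tjd Tla Tlc Tma Tmc.
  rewrite !(mulr0, mul0r, subr0, add0r, addr0, sub0r) => h.
  apply: (mulfI two0); rewrite /X /Y /cs; apply: oppr_inj.
  by transitivity (- (2 * 'i%C * e * (sind psi i l)%:C * (T i a * T l b) * (cosd phi c d)%:C));
    [ring|apply: etrans (etrans _ h) _; ring].
have e0 (z : C) : z ^+ 2 = 1 -> z != 0.
  by move=> z1; apply/eqP => z0; move: z1; rewrite z0 expr0n/= => /eqP; rewrite eq_sym oner_eq0.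
have csE f x y : (cs f x y != 0) = (f x y != 0) by rewrite fmorph_eq0.
have X0 : X != 0 by exact: mulf_neq0.
have Y0 : Y != 0.
  case: Tjm => // -[sil ccd]; apply/eqP => Y0.
  have : e * cs (sind psi) i l * X * cs (cosd phi) c d != 0.
    by rewrite !mulf_neq0// ?csE// e0.
  by rewrite eq2 Y0 mulr0 eqxx.
suff : cs (sind psi) i l * cs (sind psi) j m * (cs (cosd phi) a b * cs (cosd phi) c d) =
       cs (cosd psi) i l * cs (cosd psi) j m * (cs (sind phi) a b * cs (sind phi) c d).
  by rewrite /cs -!rmorphM => /(fmorph_inj (real_complex R)).
apply: (mulfI (mulf_neq0 X0 Y0)).
transitivity (e ^+ 2 * (X * Y * (cs (sind psi) i l * cs (sind psi) j m *
   (cs (cosd phi) a b * cs (cosd phi) c d)))); first by rewrite e1 mul1r.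
transitivity ((e * cs (sind psi) j m * Y * cs (cosd phi) a b) *
              (e * cs (sind psi) i l * X * cs (cosd phi) c d)); first by ring.
rewrite eq1 eq2.
transitivity (e' ^+ 2 * (X * Y * (cs (cosd psi) i l * cs (cosd psi) j m *
   (cs (sind phi) a b * cs (sind phi) c d)))); first by ring.
by rewrite e'1 mul1r.
Qed.

End ChangeOfVariables.

Section TanProducts.
Variables (psi phi : 'rV[R]_3) (T : 'M[C]_4).
Hypothesis T_unit : T \in unitmx.
Hypothesis T_rel :
  forall r, relation_space psi r <-> relation_space phi (T^T *m r *m T).

(** The product tan (il) tan (jm) at [psi] equals some tan (ab) tan (cd) at [phi], as points of the
    projective line; the middle clause excludes 0 / 0. The indices a, b, c, d are free because [T]
    may permute generators, which leaves finitely many values. *)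
Definition tan_products_agree i l j m := exists a b c d,
  [/\ uniq [:: a; b; c; d],
      (sin_product phi a b c d != 0) || (cos_product phi a b c d != 0) &
      sin_product psi i l j m * cos_product phi a b c d =
      cos_product psi i l j m * sin_product phi a b c d].

Lemma tan_products_agreeC i l j m :
  tan_products_agree i l j m -> tan_products_agree i l m j.
Proof.
move=> [a [b [c [d [abcd nz E]]]]]; exists a, b, d, c; split.
- by rewrite -(perm_uniq (s1 := [:: a; b; c; d]))//; apply/permP => p /=; rewrite !addn0; ring.
- by move: nz; rewrite /sin_product /cos_product (sindC phi c d) (cosdC phi c d) mulrN oppr_eq0.
move: E; rewrite /sin_product /cos_product (sindC phi c d) (cosdC phi c d).
by rewrite (sindC psi j m) (cosdC psi j m) !mulrN mulNr => ->.
Qed.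

Lemma tan_products_agreeS i l j m :
  tan_products_agree i l j m -> tan_products_agree j m i l.
Proof.
move=> [a [b [c [d [abcd nz E]]]]]; exists a, b, c, d; split => //.
by move: E; rewrite /sin_product /cos_product [sind psi i l * _]mulrC [cosd psi i l * _]mulrC.
Qed.

(** The rows i, j live on the columns [a0], [a1] and the rows l, m on [b0], [b1]. Within its block a
    row may have two nonzero entries: [a] and [b] are chosen where the rows i and l do not vanish,
    and the nonzero sine and cosine supply the second alternative of [cross_relation]. *)
Lemma tan_products_agree_block i j l m a0 a1 b0 b1 :
  uniq [:: i; l; j; m] -> uniq [:: a0; b0; a1; b1] ->
  (forall x y, x \in [:: i; j] -> y \in [:: b0; b1] -> T x y = 0) ->
  (forall x y, x \in [:: l; m] -> y \in [:: a0; a1] -> T x y = 0) ->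
  sind psi i l != 0 ->
  (forall x y, x \in [:: a0; a1] -> y \in [:: b0; b1] ->
     sind phi x y != 0 /\ cosd phi x y != 0) ->
  tan_products_agree i l j m.
Proof.
move=> iljm u Tb Ta sil nz.
have mem := uniq4_mem.
have [a [c [ac Tia]]] : exists a c, (a = a0 /\ c = a1 \/ a = a1 /\ c = a0) /\ T i a != 0.
  have [x Tix] := row_nonzero T_unit i.
  have := mem _ _ _ _ x u; rewrite !inE => /or4P[]/eqP xE; subst x.
  - by exists a0, a1; split => //; left.
  - by rewrite Tb ?inE ?eqxx ?orbT// eqxx in Tix.
  - by exists a1, a0; split => //; right.
  - by rewrite Tb ?inE ?eqxx ?orbT// eqxx in Tix.
have [b [d [bd Tlb]]] : exists b d, (b = b0 /\ d = b1 \/ b = b1 /\ d = b0) /\ T l b != 0.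
  have [x Tlx] := row_nonzero T_unit l.
  have := mem _ _ _ _ x u; rewrite !inE => /or4P[]/eqP xE; subst x.
  - by rewrite Ta ?inE ?eqxx ?orbT// eqxx in Tlx.
  - by exists b0, b1; split => //; left.
  - by rewrite Ta ?inE ?eqxx ?orbT// eqxx in Tlx.
  - by exists b1, b0; split => //; right.
have [ain cin] : a \in [:: a0; a1] /\ c \in [:: a0; a1].
  by case: ac => -[-> ->]; rewrite !inE !eqxx orbT.
have [bin din] : b \in [:: b0; b1] /\ d \in [:: b0; b1].
  by case: bd => -[-> ->]; rewrite !inE !eqxx orbT.
have abcd : uniq [:: a; b; c; d].
  case: ac => -[-> ->]; case: bd => -[-> ->] //;
  by rewrite -(perm_uniq (s1 := [:: a0; b0; a1; b1]))//; apply/permP => p /=; rewrite !addn0; ring.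
exists a, b, c, d; split => //.
  by rewrite /sin_product mulf_neq0//; apply: (nz _ _ _ _).1.
apply: cross_relation => //; try by [apply: Tb => //; rewrite !inE eqxx ?orbT|apply: Ta => //; rewrite !inE eqxx ?orbT].
by right; split => //; exact: (nz _ _ cin din).2.
Qed.

Lemma sindD (f : 'rV[R]_3) i j l : sind f i l = sind f i j * cosd f j l + cosd f i j * sind f j l.
Proof. by rewrite /sind /cosd -sinD subrKA. Qed.

Lemma cosdD (f : 'rV[R]_3) i j l : cosd f i l = cosd f i j * cosd f j l - sind f i j * sind f j l.
Proof. by rewrite /sind /cosd -cosD subrKA. Qed.

Hypothesis sin_neq0 : forall p q, sind phi p q != 0 -> sind psi p q != 0.

(** [symmetric_zero] on the diagonal: with b = a it reads 2 T_xa T_ya = 0. *)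
Lemma column_support a x y : sind psi x y != 0 -> T x a != 0 -> T y a = 0.
Proof.
move=> xy Tx; have aa : sind phi a a = 0 by rewrite /sind subrr sin0.
have /eqP := symmetric_zero T_rel aa xy.
by rewrite [T y a * _]mulrC -mulr2n mulrn_eq0/= mulf_eq0 (negbTE Tx) => /eqP.
Qed.

(** All angles are distinct mod pi, so by [column_support] a column has at most one nonzero entry
    and [T] is monomial, with permutation [s]. *)
Lemma tan_products_agree_distinct i l j m : uniq [:: i; l; j; m] ->
  (forall p q, p != q -> sind phi p q != 0) -> tan_products_agree i l j m.
Proof.
move=> iljm snz.
have /choice[s sP] x := row_nonzero T_unit x.
have T0 x y : x != y -> T y (s x) = 0.
  by move=> xy; apply: (column_support (x := x)) (sP x); apply: sin_neq0; exact: snz.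
have sinj : injective s.
  move=> x y sxy; apply/eqP; apply/negPn/negP => xy.
  by have := sP y; rewrite -sxy T0// eqxx.
have := iljm; rewrite /= !inE !negb_or => /and4P[/and3P[il ij im] /andP[lj lm] jm _].
have u : uniq [:: s i; s l; s j; s m] by rewrite -[[:: _; _; _; _]]/(map s [:: i; l; j; m]) map_inj_uniq.
exists (s i), (s l), (s j), (s m); split => //.
  have := u; rewrite /= !inE !negb_or => /and4P[/and3P[sil _ _] _ sjm _].
  by rewrite /sin_product mulf_neq0 ?snz.
apply: cross_relation => //; try by [rewrite T0|rewrite T0// eq_sym].
by left; rewrite mulf_neq0.
Qed.

Lemma sind_congruent i j l : sind phi i j = 0 ->
  (sind phi i l != 0 -> sind phi j l != 0) /\ (cosd phi i l != 0 -> cosd phi j l != 0).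
Proof.
move=> ij0; rewrite (sindD phi i j l) (cosdD phi i j l) ij0 !mul0r add0r subr0.
by rewrite !mulf_eq0 !negb_or; split => /andP[].
Qed.

(** Angles i and j agree mod pi, and neither is congruent to angle l or m. The matrix [T] then
    respects the partition {i, j} | {l, m}, possibly exchanging the two blocks. *)
Lemma tan_products_agree_congruent i l j m : uniq [:: i; l; j; m] ->
  sind phi i j = 0 ->
  sind phi i l != 0 -> cosd phi i l != 0 -> sind phi j m != 0 -> cosd phi j m != 0 ->
  tan_products_agree i l j m.
Proof.
move=> iljm ij0 sil cil sjm cjm.
have ji0 : sind phi j i = 0 by rewrite sindC ij0 oppr0.
have [/(_ sil) sjl /(_ cil) cjl] := sind_congruent l ij0.
have [/(_ sjm) sim /(_ cjm) cim] := sind_congruent m ji0.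
have nz x y : x \in [:: i; j] -> y \in [:: l; m] -> sind phi x y != 0 /\ cosd phi x y != 0.
  by rewrite !inE => /orP[]/eqP-> /orP[]/eqP->.
have := iljm; rewrite /= !inE !negb_or => /and4P[/and3P[il ij im] /andP[lj lm] jm _].
have split_col a x y : x \in [:: i; j] -> y \in [:: l; m] -> T x a != 0 -> T y a = 0.
  move=> xX yY Tx; apply: (column_support _ Tx); apply: sin_neq0.
  exact: (nz _ _ xX yY).1.
have split_col' a x y : x \in [:: i; j] -> y \in [:: l; m] -> T y a != 0 -> T x a = 0.
  move=> xX yY Ty; apply: (column_support _ Ty); rewrite sindC oppr_eq0; apply: sin_neq0.
  exact: (nz _ _ xX yY).1.
have cross x y : x \in [:: i; j] -> y \in [:: l; m] ->
    T x i * T y j + T y i * T x j = 0.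
  move=> xX yY; apply: (symmetric_zero T_rel ij0); apply: sin_neq0.
  exact: (nz _ _ xX yY).1.
have colXY a : (T l a = 0 /\ T m a = 0) \/ (T i a = 0 /\ T j a = 0).
  have [Ti0|Ti] := eqVneq (T i a) 0; last first.
    by left; split; apply: (split_col a i) => //; rewrite !inE eqxx ?orbT.
  have [Tj0|Tj] := eqVneq (T j a) 0; last first.
    by left; split; apply: (split_col a j) => //; rewrite !inE eqxx ?orbT.
  by right.
have iljm' p : [|| p == i, p == l, p == j | p == m].
  by have := uniq4_mem p iljm; rewrite !inE.
have iX : i \in [:: i; j] by rewrite !inE eqxx.
have jX : j \in [:: i; j] by rewrite !inE eqxx orbT.
have lY : l \in [:: l; m] by rewrite !inE eqxx.
have mY : m \in [:: l; m] by rewrite !inE eqxx orbT.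
have rowsX a : (forall b, b != a -> T i b = 0 /\ T j b = 0) -> False.
  by move=> h; apply: (rows_independent T_unit (x := i) (y := j) (a := a)) => // b /h[].
have rowsY a : (forall b, b != a -> T l b = 0 /\ T m b = 0) -> False.
  by move=> h; apply: (rows_independent T_unit (x := l) (y := m) (a := a)) => // b /h[].
(* The columns i and j lie in the same block of rows: a nonzero entry of column i in one block
   kills, by [cross], the entries of column j in the other. *)
have [|] : (T l i = 0 /\ T m i = 0) /\ (T l j = 0 /\ T m j = 0) \/
            (T i i = 0 /\ T j i = 0) /\ (T i j = 0 /\ T j j = 0).
- have uT : T^T \in unitmx by rewrite unitmx_tr.
  have [x] := row_nonzero uT i; rewrite mxE => Txi.
  have [xX|xY] : x \in [:: i; j] \/ x \in [:: l; m].
    by have /or4P[] := iljm' x => /eqP->; rewrite !inE eqxx ?orbT; [left|right|left|right].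
  + left; have Ti y : y \in [:: l; m] -> T y i = 0 by move=> yY; exact: split_col Txi.
    have Tj y : y \in [:: l; m] -> T y j = 0.
      move=> yY; have /eqP := cross x y xX yY.
      by rewrite (Ti y yY) mul0r addr0 mulf_eq0 (negbTE Txi) => /eqP.
    by split; split; auto.
  + right; have Ti y : y \in [:: i; j] -> T y i = 0 by move=> yX; exact: split_col' Txi.
    have Tj y : y \in [:: i; j] -> T y j = 0.
      move=> yX; have /eqP := cross y x yX xY.
      by rewrite (Ti y yX) mul0r add0r mulf_eq0 (negbTE Txi) => /eqP.
    by split; split; auto.
- move=> [[li mi] [lj0 mj]].
  (* If column l also lived on the rows i, j, the rows l and m would both be supported on the single
     column m, against invertibility. *)
  have [il0 jl0] : T i l = 0 /\ T j l = 0.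
    have [[ll ml]|//] := colXY l; exfalso; apply: (rowsY m) => b bm.
    by have /or4P[] := iljm' b => /eqP bE; rewrite bE ?eqxx// in bm *.
  have [im0 jm0] : T i m = 0 /\ T j m = 0.
    have [[lm0 mm]|//] := colXY m; exfalso; apply: (rowsY l) => b bl.
    by have /or4P[] := iljm' b => /eqP bE; rewrite bE ?eqxx// in bl *.
  apply: (@tan_products_agree_block i j l m i j l m) => //.
  + by move=> x y; rewrite !inE => /orP[]/eqP-> /orP[]/eqP->.
  + by move=> x y; rewrite !inE => /orP[]/eqP-> /orP[]/eqP->.
  + exact: sin_neq0.
- move=> [[ii ji] [ij1 jj]].
  have [ll ml] : T l l = 0 /\ T m l = 0.
    have [//|[il0 jl0]] := colXY l; exfalso; apply: (rowsX m) => b bm.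
    by have /or4P[] := iljm' b => /eqP bE; rewrite bE ?eqxx// in bm *.
  have [lm0 mm] : T l m = 0 /\ T m m = 0.
    have [//|[im0 jm0]] := colXY m; exfalso; apply: (rowsX l) => b bl.
    by have /or4P[] := iljm' b => /eqP bE; rewrite bE ?eqxx// in bl *.
  apply: (@tan_products_agree_block i j l m l m i j) => //.
  + have := iljm; rewrite /= !inE !negb_or !andbT.
    by rewrite (eq_sym l i) (eq_sym m j) il ij im lj lm jm.
  + by move=> x y; rewrite !inE => /orP[]/eqP-> /orP[]/eqP->.
  + by move=> x y; rewrite !inE => /orP[]/eqP-> /orP[]/eqP->.
  + exact: sin_neq0.
  + by move=> x y xY yX; rewrite sindC cosdC oppr_eq0; exact: nz.
Qed.

(** A pair congruent mod pi cannot be {i, l} or {j, m}, whose sines are nonzero. It joins the two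
    pairs, and the symmetries of the tangent product reduce it to {i, j}. *)
Theorem tan_products_agree_nondegenerate i l j m : uniq [:: i; l; j; m] ->
  sind phi i l != 0 -> cosd phi i l != 0 -> sind phi j m != 0 -> cosd phi j m != 0 ->
  tan_products_agree i l j m.
Proof.
move=> iljm sil cil sjm cjm.
have [snz|] := pselect (forall p q, p != q -> sind phi p q != 0).
  exact: tan_products_agree_distinct.
move=> /existsNP[p /existsNP[q /not_implyP[pq /negP/negPn/eqP pq0]]].
have uC : uniq [:: i; l; m; j] /\ uniq [:: l; i; j; m] /\ uniq [:: l; i; m; j].
  have := iljm; rewrite /= !inE !negb_or !andbT.
  rewrite (eq_sym l i) (eq_sym m j).
  by move=> /and3P[/and3P[-> -> ->] /andP[-> ->] ->].
have sC x y : sind phi x y != 0 -> sind phi y x != 0 by rewrite sindC oppr_eq0.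
have cC x y : cosd phi x y != 0 -> cosd phi y x != 0 by rewrite cosdC.
have swap x y z t : tan_products_agree x y z t -> tan_products_agree y x z t.
  by move=> /tan_products_agreeS/tan_products_agreeC/tan_products_agreeS.
have main x y : x \in [:: i; l] -> y \in [:: j; m] -> sind phi x y = 0 ->
    tan_products_agree i l j m.
  rewrite !inE => /orP[]/eqP-> /orP[]/eqP-> xy0.
  - exact: tan_products_agree_congruent.
  - by apply: tan_products_agreeC; apply: tan_products_agree_congruent; auto; case: uC.
  - by apply: swap; apply: tan_products_agree_congruent; auto; case: uC => _ [].
  - by apply: swap; apply: tan_products_agreeC; apply: tan_products_agree_congruent; auto; case: uC => _ [].
have qp0 : sind phi q p = 0 by rewrite sindC pq0 oppr0.
have := uniq4_mem p iljm; have := uniq4_mem q iljm; rewrite !inE.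
move=> /or4P[]/eqP qE /or4P[]/eqP pE; subst p q; rewrite ?eqxx// in pq.
all: try by rewrite ?pq0 ?qp0 eqxx in sil.
all: try by rewrite ?pq0 ?qp0 eqxx in sjm.
all: try by apply: main pq0; rewrite !inE eqxx ?orbT.
all: by apply: main qp0; rewrite !inE eqxx ?orbT.
Qed.

(** The antisymmetric parts of relations fill all antisymmetric matrices supported where the cosine
    is nonzero. [T] maps those of [psi] into those of [phi], and [supported_rank] concludes. The
    diagonal is excluded because antisymmetric matrices do not see it. *)
Lemma cosd_pattern : (forall p q, cosd phi p q != 0 -> cosd psi p q != 0) ->
  forall p q, p != q -> cosd psi p q != 0 -> cosd phi p q != 0.
Proof.
move=> EE p q pq cpq.
have two0 : (2 : C) != 0 by rewrite pnatr_eq0.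
pose E (f : 'rV[R]_3) : rel 'I_4 := fun x y => cosd f x y != 0.
have Es (f : 'rV[R]_3) : symmetric (E f) by move=> x y; rewrite /E cosdC.
have supp m : supported (-1) (E psi) m -> supported (-1) (E phi) (congruence T m).
  move=> [mT m0].
  have mN x y : m x y = - m y x.
    by have := congr1 (fun M : 'M[C]_4 => M y x) mT; rewrite !mxE mulN1r.
  (* The Hodge coefficients of a relation with antisymmetric part [m]. Where the cosine vanishes,
     division by zero gives 0, in agreement with [m] being 0 there. *)
  pose f x y : C := m x y / (2 * (cosd psi x y)%:C).
  have fN x y : f x y = - f y x by rewrite /f mN cosdC mulNr.
  have [alpha [beta hf]] := hodge_antisymmetric fN.
  pose r := relation_mx psi alpha beta.
  have mE : m = r - r^T.
    apply/matrixP => x y; rewrite mxEB [r^T _ _]mxE relation_mx_antisym hf /f.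
    have [c0|/m0 ->] := boolP (E psi x y); last by rewrite mul0r mulr0 mul0r.
    have cC0 : (cosd psi x y)%:C != 0 by rewrite fmorph_eq0.
    by field; rewrite cC0.
  have cE : congruence T m = congruence T r - (congruence T r)^T.
    by rewrite mE /congruence mulmxBr mulmxBl !trmx_mul trmxK mulmxA.
  split=> [|x y /negPn/eqP cxy].
    by rewrite /congruence !trmx_mul trmxK mT mulmxA scaleN1r mulmxN mulNmx scaleN1r.
  rewrite cE mxEB [X in _ - X]mxE.
  have /T_rel[a [b hr]] : relation_space psi r by exists alpha, beta.
  rewrite -/(congruence T r) in hr; rewrite hr.
  by rewrite relation_mx_antisym cxy mulr0.
have := @supported_rank _ two0 _ (E psi) (E phi) T (-1) (Es psi) (Es phi) _ T_unit EE supp.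
rewrite sqrrN expr1n => /(_ erefl (delta_mx p q - delta_mx q p))[|_].
  split=> [|x y nE]; first by rewrite linearB /= !trmx_delta scaleN1r opprB.
  have xpq : ((x == p) && (y == q)) = false.
    by apply: contraNF nE => /andP[/eqP-> /eqP->].
  have xqp : ((x == q) && (y == p)) = false.
    by apply: contraNF nE => /andP[/eqP-> /eqP->]; rewrite /E cosdC.
  by rewrite mxEB !mxE xpq xqp subrr.
move=> h; apply: contraT => /h.
by rewrite mxEB !mxE !eqxx (negbTE pq) subr0 => /eqP; rewrite oner_eq0.
Qed.

(** The same dimension argument on symmetric parts, whose support is given by the sines. *)
Lemma sind_pattern : (forall p q, sind phi p q != 0 -> sind psi p q != 0) ->
  forall p q, sind psi p q != 0 -> sind phi p q != 0.
Proof.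
move=> EE p q spq.
have two0 : (2 : C) != 0 by rewrite pnatr_eq0.
have pq : p != q by apply: contraNneq spq => ->; rewrite /sind subrr sin0.
pose E (f : 'rV[R]_3) : rel 'I_4 := fun x y => sind f x y != 0.
have Es (f : 'rV[R]_3) : symmetric (E f) by move=> x y; rewrite /E sindC oppr_eq0.
have supp m : supported 1 (E psi) m -> supported 1 (E phi) (congruence T m).
  rewrite /supported !scale1r => -[mT m0].
  have mN x y : m x y = m y x.
    by have := congr1 (fun M : 'M[C]_4 => M y x) mT; rewrite !mxE.
  pose f x y : C := - (m x y / (2 * 'i%C * (sind psi x y)%:C)).
  have fN x y : f x y = - f y x.
    by rewrite /f mN (sindC psi y x) rmorphN mulrN invrN mulrN.
  have [beta [alpha hf]] := hodge_antisymmetric fN.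
  pose r := relation_mx psi alpha beta.
  have mE : m = r + r^T.
    apply/matrixP => x y; rewrite mxED [r^T _ _]mxE relation_mx_sym hf /f.
    have [c0|/m0 ->] := boolP (E psi x y); last by rewrite mul0r oppr0 mulr0 mul0r oppr0.
    have cC0 : (sind psi x y)%:C != 0 by rewrite fmorph_eq0.
    by field; rewrite cC0 complex_i_neq0.
  have cE : congruence T m = congruence T r + (congruence T r)^T.
    by rewrite mE /congruence mulmxDr mulmxDl !trmx_mul trmxK mulmxA.
  split=> [|x y /negPn/eqP cxy].
    by rewrite /congruence !trmx_mul trmxK mT mulmxA.
  rewrite cE mxED [X in _ + X]mxE.
  have /T_rel[a [b hr]] : relation_space psi r by exists alpha, beta.
  rewrite -/(congruence T r) in hr; rewrite hr.
  by rewrite relation_mx_sym cxy mulr0 oppr0.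
have := @supported_rank _ two0 _ (E psi) (E phi) T 1 (Es psi) (Es phi) _ T_unit EE supp.
rewrite expr1n => /(_ erefl (delta_mx p q + delta_mx q p))[|_].
  split=> [|x y nE]; first by rewrite linearD /= !trmx_delta scale1r addrC.
  have xpq : ((x == p) && (y == q)) = false.
    by apply: contraNF nE => /andP[/eqP-> /eqP->].
  have xqp : ((x == q) && (y == p)) = false.
    by apply: contraNF nE => /andP[/eqP-> /eqP->]; rewrite /E sindC oppr_eq0.
  by rewrite mxED !mxE xpq xqp addr0.
move=> h; apply: contraT => /h.
by rewrite mxED !mxE !eqxx (negbTE pq) addr0 => /eqP; rewrite oner_eq0.
Qed.

End TanProducts.
End Invariants.

Theorem scale_equivalent_invariants (R : realType) (psi phi : 'rV[R]_3) :
  scale_equivalent (torus_point psi) (torus_point phi) ->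
  (forall p q, sind phi p q != 0 -> sind psi p q != 0) ->
  (forall p q, cosd phi p q != 0 -> cosd psi p q != 0) ->
  [/\ forall p q, sind phi p q = 0 -> sind psi p q = 0,
      forall p q, cosd phi p q = 0 -> cosd psi p q = 0 &
      forall i l j m, uniq [:: i; l; j; m] ->
        sind phi i l != 0 -> cosd phi i l != 0 ->
        sind phi j m != 0 -> cosd phi j m != 0 ->
        tan_products_agree psi phi i l j m].
Proof.
move=> /scale_equivalent_matrix[T Tu TR] sE cE; split.
- move=> p q /eqP s0; apply/eqP; apply: contraTT s0 => /(sind_pattern Tu TR sE).
  by [].
- move=> p q /eqP c0; apply/eqP; apply: contraTT c0 => cpsi.
  have [->|pq] := eqVneq p q; first by rewrite /cosd subrr cos0 oner_eq0.
  exact: (cosd_pattern Tu TR cE pq cpsi).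
- by move=> i l j m u *; exact: (tan_products_agree_nondegenerate Tu TR sE u).
Qed.

(** * The flow of Z and its first integrals *)

Section Flow.
Variable R : realType.
Implicit Types (phi psi : 'rV[R]_3) (gamma : R -> 'rV[R]_3).

Lemma sinMsin (a b : R) : sin a * sin b = (cos (a - b) - cos (a + b)) / 2.
Proof. by rewrite cosB cosD; field. Qed.

Lemma sin_double (y : R) : sin (2 * y) = 2 * sin y * cos y.
Proof.
have -> : 2 * y = y + y by ring.
by rewrite sinD; ring.
Qed.

Definition speed phi (k : 'I_3) : R :=
  sin (phi ord0 (k + 1) + phi ord0 (k + 2%:R) - phi ord0 k).

Lemma vector_field_ZE phi k : vector_field_Z phi ord0 k = sin (2 * phi ord0 k) * speed phi k.
Proof. by rewrite mxE. Qed.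

Lemma ord3_cycle (k : 'I_3) :
  [/\ k + 1 + 1 = k + 2%:R, k + 1 + 2%:R = k, k + 2%:R + 1 = k & k + 2%:R + 2%:R = k + 1].
Proof. by case: k => -[|[|[|//]]] ?; split; exact: val_inj. Qed.

(** The identity behind the choice of Z: phi_l - phi_m obeys the equation of phi_k with the same
    [speed] and the opposite sign. *)
Lemma vector_field_Z_diff phi k :
  vector_field_Z phi ord0 (k + 1) - vector_field_Z phi ord0 (k + 2%:R) =
  - (sin (2 * (phi ord0 (k + 1) - phi ord0 (k + 2%:R))) * speed phi k).
Proof.
have [k11 k12 k21 k22] := ord3_cycle k.
rewrite !vector_field_ZE /speed k11 k12 k21 k22.
move: (phi ord0 k) (phi ord0 (k + 1)) (phi ord0 (k + 2%:R)) => x y z.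
rewrite !sinMsin -mulrBl -mulNr; congr (_ / 2).
have -> : 2 * (y - z) - (y + z - x) = - (2 * z - (x + y - z)) by ring.
have -> : 2 * (y - z) + (y + z - x) = 2 * y - (z + x - y) by ring.
have -> : 2 * z + (x + y - z) = 2 * y + (z + x - y) by ring.
by rewrite cosN; ring.
Qed.

Lemma exponential_solution (f g G : R -> R) : G 0 = 0 ->
  (forall s, is_derive s (1 : R) G (g s)) ->
  (forall s, is_derive s (1 : R) f (g s * f s)) ->
  forall t, f t = f 0 * expR (G t).
Proof.
move=> G0 dG df t.
have dE s : is_derive s (1 : R) (fun s => expR (- G s)) (expR (- G s) * - g s).
  exact: (is_derive1_comp (is_derive_expR _) (is_deriveN (dG s))).
have dh s : is_derive s (1 : R) (fun s => f s * expR (- G s)) 0.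
  apply: (is_derive_eq (is_deriveM (df s) (dE s))).
  by rewrite /GRing.scale/=; ring.
have := is_derive_0_is_cst t 0 dh; rewrite /= G0 oppr0 expR0 mulr1 => <-.
by rewrite -mulrA -expRD addNr expR0 mulr1.
Qed.

Section IntegralCurve.
Variable gamma : R -> 'rV[R]_3.
Hypothesis gammaZ : forall s, is_derive s (1 : R) gamma (vector_field_Z (gamma s)).

Let x k s := gamma s ord0 k.

Lemma curve_coordinate k s : is_derive s (1 : R) (x k) (sin (2 * x k s) * speed (gamma s) k).
Proof.
by have /is_derive_rowP/(_ k) := gammaZ s; rewrite vector_field_ZE.
Qed.

Lemma curve_difference k s : is_derive s (1 : R) (fun s => x (k + 1) s - x (k + 2%:R) s)
  (- (sin (2 * (x (k + 1) s - x (k + 2%:R) s)) * speed (gamma s) k)).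
Proof.
have /is_derive_rowP h := gammaZ s.
by have := is_deriveB (h (k + 1)) (h (k + 2%:R)); rewrite vector_field_Z_diff.
Qed.

Lemma is_derive_sin_comp (f : R -> R) s df : is_derive s (1 : R) f df ->
  is_derive s (1 : R) (fun s => sin (f s)) (cos (f s) * df).
Proof. by move=> h; exact: (is_derive1_comp (is_derive_sin _) h). Qed.

Lemma is_derive_cos_comp (f : R -> R) s df : is_derive s (1 : R) f df ->
  is_derive s (1 : R) (fun s => cos (f s)) (- sin (f s) * df).
Proof. by move=> h; exact: (is_derive1_comp (is_derive_cos _) h). Qed.

Lemma curve_continuous k : continuous (x k).
Proof. by move=> s; exact: is_derive_continuous (curve_coordinate k s). Qed.

(* Along the flow tan phi_k is multiplied by r and tan (phi_l - phi_m) by 1 / r. *)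
Theorem flow_proportional t : exists p q r : 'I_3 -> R,
  (forall k, [/\ 0 < p k, 0 < q k & 0 < r k]) /\
  proportional (gamma 0) (gamma t) p q r.
Proof.
suff /choice[p /choice[q /choice[r h]]] k : exists p q r, [/\ 0 < p, 0 < q & 0 < r] /\
  [/\ cos (x k t) = p * cos (x k 0),
      sin (x (k + 1) t - x (k + 2%:R) t) = p * r * sin (x (k + 1) 0 - x (k + 2%:R) 0),
      cos (x (k + 1) t - x (k + 2%:R) t) = q * cos (x (k + 1) 0 - x (k + 2%:R) 0) &
      sin (x k t) = q / r * sin (x k 0)].
  by exists p, q, r; split=> k; have [] := h k.
pose d s := x (k + 1) s - x (k + 2%:R) s.
pose A s := speed (gamma s) k.
have cx j : continuous (x j) by exact: curve_continuous.
have cd : continuous d by move=> s; apply: continuousB; exact: cx.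
have cA : continuous A.
  move=> s; apply: (@continuous_comp _ _ _ (fun s => x (k + 1) s + x (k + 2%:R) s - x k s) sin).
    by apply: continuousB; [apply: continuousD|]; exact: cx.
  exact: continuous_sin.
have ctrig (f : R -> R) : continuous f ->
    continuous (fun s => sin (f s) ^+ 2 * A s) /\ continuous (fun s => cos (f s) ^+ 2 * A s).
  move=> cf.
  have sq (h : R -> R) : continuous h -> continuous (fun s => h (f s) ^+ 2 * A s).
    move=> ch s; apply: (@continuousM R R (fun s => h (f s) ^+ 2) A s); last exact: cA.
    apply: (@continuous_comp _ _ _ (h \o f) (fun y => y ^+ 2)).
      by apply: continuous_comp; [exact: cf|exact: ch].
    exact: exprn_continuous.
  by split; apply: sq; [exact: continuous_sin|exact: continuous_cos].
have [Gs Gs0 dGs] := continuous_has_antiderivative (ctrig _ (cx k)).1.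
have [Gc Gc0 dGc] := continuous_has_antiderivative (ctrig _ (cx k)).2.
have [Hs Hs0 dHs] := continuous_has_antiderivative (ctrig _ cd).1.
have [Hc Hc0 dHc] := continuous_has_antiderivative (ctrig _ cd).2.
(* Both sides are antiderivatives of [A], as sin^2 + cos^2 = 1. This is the conservation of tan
   phi_k tan (phi_l - phi_m). *)
have GH s : Gs s + Gc s = Hs s + Hc s.
  have dd y : is_derive y (1 : R) (fun y => (Gs y + Gc y) - (Hs y + Hc y)) 0.
    apply: (is_derive_eq (is_deriveB (is_deriveD (dGs y) (dGc y)) (is_deriveD (dHs y) (dHc y)))).
    by rewrite -!mulrDl ![sin _ ^+ 2 + _]addrC !cos2Dsin2 subrr.
  have := is_derive_0_is_cst s 0 dd.
  by rewrite Gs0 Gc0 Hs0 Hc0 addr0 subrr => /eqP; rewrite subr_eq0 => /eqP.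
have dZ (G g : R -> R) (c : R) : (forall s, is_derive s (1 : R) G (g s)) ->
    forall s, is_derive s (1 : R) (fun s => c * G s) (c * g s).
  by move=> dG s; have := is_deriveZ c (dG s).
have cosx := @exponential_solution (fun s => cos (x k s)) _ (fun s => -2 * Gs s) _ (dZ _ _ (-2) dGs).
have sinx := @exponential_solution (fun s => sin (x k s)) _ (fun s => 2 * Gc s) _ (dZ _ _ 2 dGc).
have cosdd := @exponential_solution (fun s => cos (d s)) _ (fun s => 2 * Hs s) _ (dZ _ _ 2 dHs).
have sindd := @exponential_solution (fun s => sin (d s)) _ (fun s => -2 * Hc s) _ (dZ _ _ (-2) dHc).
(* [p] and [q] are the growth factors of the two cosines. The third is chosen so that [p * r] is the
   growth factor of sin (phi_l - phi_m); then [q / r] is that of sin phi_k, by [GH]. *)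
exists (expR (-2 * Gs t)), (expR (2 * Hs t)), (expR (2 * Gs t - 2 * Hc t)).
split; first by rewrite !expR_gt0.
rewrite -expRD -expRB; split.
- rewrite [RHS]mulrC; apply: cosx; first by rewrite Gs0 mulr0.
  move=> s; apply: (is_derive_eq (is_derive_cos_comp (curve_coordinate k s))).
  by rewrite sin_double -/(A s); ring.
- have -> : -2 * Gs t + (2 * Gs t - 2 * Hc t) = -2 * Hc t by ring.
  rewrite [RHS]mulrC; apply: sindd; first by rewrite Hc0 mulr0.
  move=> s; apply: (is_derive_eq (is_derive_sin_comp (curve_difference k s))).
  by rewrite sin_double -/(A s) -/(d s); ring.
- rewrite [RHS]mulrC; apply: cosdd; first by rewrite Hs0 mulr0.
  move=> s; apply: (is_derive_eq (is_derive_cos_comp (curve_difference k s))).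
  by rewrite sin_double -/(A s) -/(d s); ring.
- have -> : 2 * Hs t - (2 * Gs t - 2 * Hc t) = 2 * Gc t.
    by have := GH t; lra.
  rewrite [RHS]mulrC; apply: sinx; first by rewrite Gc0 mulr0.
  move=> s; apply: (is_derive_eq (is_derive_sin_comp (curve_coordinate k s))).
  by rewrite sin_double -/(A s); ring.
Qed.
End IntegralCurve.

(* The vector field is bounded and Lipschitz, so its integral curves are global. *)
Lemma sin_lipschitz (a b : R) : `|sin a - sin b| <= `|a - b|.
Proof.
wlog ab : a b / b <= a => [wl|].
  have [|/ltW h] := leP b a; first exact: wl.
  by rewrite distrC [leRHS]distrC; exact: wl.
have [|c _ ->] := @MVT_segment R sin cos b a ab (fun x _ => is_derive_sin x).
  by apply: continuous_subspaceT => x; exact: continuous_sin.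
rewrite normrM -[leRHS]mul1r ler_wpM2r// ler_norml cos_geN1 cos_le1//.
Qed.

Theorem integral_curve_exists phi : exists2 gamma : R -> 'rV[R]_3, gamma 0 = phi &
  forall s, is_derive s (1 : R) gamma (vector_field_Z (gamma s)).
Proof.
(* The Lipschitz constant is 5 = 2 + 3: the factor sin (2 phi_k) contributes 2 and the speed, a sine
   of three coordinates, contributes 3. *)
apply: (@bounded_lipschitz_flow R 3 (@vector_field_Z R) 5 1) => //.
- move=> a b; apply/row_norm_leP => [|k]; first exact: mulr_ge0.
  have h j : `|a ord0 j - b ord0 j| <= `|a - b|.
    by have /row_norm_leP := lexx `|a - b| => /(_ (normr_ge0 _) j); rewrite !mxE.
  rewrite mxE [X in _ + X]mxE !vector_field_ZE.
  have -> : sin (2 * a ord0 k) * speed a k - sin (2 * b ord0 k) * speed b k =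
    (sin (2 * a ord0 k) - sin (2 * b ord0 k)) * speed a k +
    sin (2 * b ord0 k) * (speed a k - speed b k) by ring.
  have s1 (y : R) : `|sin y| <= 1 by rewrite ler_norml sin_geN1 sin_le1.
  apply: (le_trans (ler_normD _ _)); rewrite !normrM.
  have b1 : `|sin (2 * a ord0 k) - sin (2 * b ord0 k)| * `|speed a k| <= 2 * `|a - b|.
    rewrite -[leRHS]mulr1; apply: ler_pM => //; last exact: s1.
    by rewrite (le_trans (sin_lipschitz _ _))// -mulrBr normrM ger0_norm// ler_wpM2l.
  have b2 : `|sin (2 * b ord0 k)| * `|speed a k - speed b k| <= 3 * `|a - b|.
    rewrite -[leRHS]mul1r; apply: ler_pM => //.
    rewrite (le_trans (sin_lipschitz _ _))//.
    have -> : a ord0 (k + 1) + a ord0 (k + 2%:R) - a ord0 k -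
      (b ord0 (k + 1) + b ord0 (k + 2%:R) - b ord0 k) =
      (a ord0 (k + 1) - b ord0 (k + 1)) + (a ord0 (k + 2%:R) - b ord0 (k + 2%:R)) -
      (a ord0 k - b ord0 k) by ring.
    have := ler_normB ((a ord0 (k + 1) - b ord0 (k + 1)) + (a ord0 (k + 2%:R) - b ord0 (k + 2%:R)))
      (a ord0 k - b ord0 k).
    have := ler_normD (a ord0 (k + 1) - b ord0 (k + 1)) (a ord0 (k + 2%:R) - b ord0 (k + 2%:R)).
    have := h k; have := h (k + 1); have := h (k + 2%:R); lra.
  lra.
- move=> a; apply/row_norm_leP => // k; rewrite vector_field_ZE normrM.
  by rewrite mulr_ile1// ler_norml sin_geN1 sin_le1.
Qed.
End Flow.

(** * Nearby points with the same invariants lie on one orbit *)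

Section LocalRigidity.
Variable R : realType.
Implicit Types (phi psi : 'rV[R]_3).

(** Zeros are transported only from [phi] to [psi], since nonvanishing persists near [phi] by
    continuity. The last clause equates tangent products, cross-multiplied to make sense at the
    poles. *)
Definition same_type psi phi :=
  [/\ forall p q, sind phi p q = 0 -> sind psi p q = 0,
      forall p q, cosd phi p q = 0 -> cosd psi p q = 0 &
      forall i l j m, uniq [:: i; l; j; m] ->
        sin_product psi i l j m * cos_product phi i l j m =
        cos_product psi i l j m * sin_product phi i l j m].

Lemma near_neq0 (f : 'rV[R]_3 -> R) phi : {for phi, continuous f} -> f phi != 0 ->
  \forall psi \near phi, f psi != 0.
Proof. by move=> cf f0; exact: (cvgr_neq0 _ cf f0). Qed.

Lemma angle_continuous p : continuous (fun phi => angle phi p).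
Proof.
move=> phi; rewrite /angle; case: (unlift ord0 p) => [k|]; last first.
  exact: (@cst_continuous _ _ (0 : R) phi).
exact: coord_continuous.
Qed.

Lemma sind_continuous p q : continuous (fun phi => sind phi p q).
Proof.
move=> phi; apply: (@continuous_comp _ _ _ (fun phi => angle phi p - angle phi q) sin).
  by apply: continuousB; exact: angle_continuous.
exact: continuous_sin.
Qed.

Lemma cosd_continuous p q : continuous (fun phi => cosd phi p q).
Proof.
move=> phi; apply: (@continuous_comp _ _ _ (fun phi => angle phi p - angle phi q) cos).
  by apply: continuousB; exact: angle_continuous.
exact: continuous_cos.
Qed.

Lemma near_imply_neq0 (I : finType) (f : I -> 'rV[R]_3 -> R) phi :
  (forall i, continuous (f i)) ->
  \forall psi \near phi, forall i, f i phi != 0 -> f i psi != 0.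
Proof.
move=> cf; apply: (@filter_forall _ I (fun i psi => f i phi != 0 -> f i psi != 0) (nbhs phi) _) => i.
have [f0|f0] := eqVneq (f i phi) 0; first exact: filterE.
by apply: filterS (near_neq0 (@cf i phi) f0) => psi.
Qed.

Lemma proportional_pairs (x y x0 y0 s c : R) : (s != 0) || (c != 0) ->
  x * c = y * s -> x0 * c = y0 * s -> x * y0 = y * x0.
Proof.
move=> /orP[s0|c0] h h0.
  apply: (mulfI s0).
  by rewrite mulrCA [s * y0]mulrC -h0 mulrCA [s * (y * _)]mulrA [s * y]mulrC -h; ring.
apply: (mulfI c0).
by rewrite [LHS]mulrA [c * x]mulrC h mulrCA [c * x0]mulrC h0; ring.
Qed.

(* The invariants tan tan take finitely many values on an isomorphism class, so
   nearby points of the class share them. *)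
Lemma near_same_type phi : \forall psi \near phi,
  scale_equivalent (torus_point psi) (torus_point phi) -> same_type psi phi.
Proof.
have sN := @near_imply_neq0 ('I_4 * 'I_4)%type (fun i psi => sind psi i.1 i.2) phi
  (fun i => @sind_continuous i.1 i.2).
have cN := @near_imply_neq0 ('I_4 * 'I_4)%type (fun i psi => cosd psi i.1 i.2) phi
  (fun i => @cosd_continuous i.1 i.2).
(* The defect between the tangent product of indices [x] at [psi] and that of indices [y] at [phi].
   If it vanishes at some [psi] near enough to [phi], it vanishes at [phi]. *)
pose F (x y : 'I_4 * 'I_4 * 'I_4 * 'I_4) psi :=
  sin_product psi x.1.1.1 x.1.1.2 x.1.2 x.2 * cos_product phi y.1.1.1 y.1.1.2 y.1.2 y.2 -
  cos_product psi x.1.1.1 x.1.1.2 x.1.2 x.2 * sin_product phi y.1.1.1 y.1.1.2 y.1.2 y.2.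
have cF x y : continuous (F x y).
  have cM (f g : 'rV[R]_3 -> R) : continuous f ->
      continuous g -> continuous (fun psi => f psi * g psi).
    by move=> cf cg psi; apply: continuousM; [exact: cf|exact: cg].
  have cB (f g : 'rV[R]_3 -> R) : continuous f ->
      continuous g -> continuous (fun psi => f psi - g psi).
    by move=> cf cg psi; apply: continuousB; [exact: cf|exact: cg].
  have cc (c : R) : continuous ((fun=> c) : 'rV[R]_3 -> R)
    by move=> psi; exact: (@cst_continuous _ _ c psi).
  by apply: cB; apply: (cM _ _ (cM _ _ _ _) (cc _));
    first [exact: sind_continuous|exact: cosd_continuous].
have FN := @near_imply_neq0 _ (fun xy => F xy.1 xy.2) phi (fun xy => @cF xy.1 xy.2).
apply: filterS3 sN cN FN => psi sE cE FE /scale_equivalent_invariants.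
move=> /(_ (fun p q => sE (p, q)) (fun p q => cE (p, q)))[sP cP tan_agree]; split => // i l j m u.
rewrite /sin_product /cos_product.
have [sil|sil] := eqVneq (sind phi i l) 0; first by rewrite sil (sP _ _ sil) !mul0r mulr0.
have [sjm|sjm] := eqVneq (sind phi j m) 0; first by rewrite sjm (sP _ _ sjm) !mulr0 mul0r.
have [cil|cil] := eqVneq (cosd phi i l) 0; first by rewrite cil (cP _ _ cil) !mul0r mulr0.
have [cjm|cjm] := eqVneq (cosd phi j m) 0; first by rewrite cjm (cP _ _ cjm) !mulr0 mul0r.
have [a [b [c [d [_ nz E]]]]] := tan_agree _ _ _ _ u sil cil sjm cjm.
apply: (proportional_pairs nz E); apply/eqP; rewrite -subr_eq0; apply/negPn/negP.
by move=> /(FE ((i, l, j, m), (a, b, c, d))); rewrite /F /= E subrr eqxx.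
Qed.

Lemma sin_sum_eq0 (a b : R) : sin a = 0 -> sin b = 0 -> sin (a + b) = 0.
Proof. by move=> a0 b0; rewrite sinD a0 b0 mul0r mulr0 addr0. Qed.

(** The bound 2 serves as a simple lower bound of pi. *)
Lemma sin_small_eq0 (x : R) : `|x| < 2 -> sin x = 0 -> x = 0.
Proof.
have p : 0 < x < 2 -> 0 < sin x.
  by move=> /andP[x0 x2]; apply: sin_gt0_pi; rewrite x0/= (lt_le_trans x2 (pi_ge2 R)).
have n : 0 < - x < 2 -> 0 < - sin x.
  move=> /andP[x0 x2]; rewrite -sinN; apply: sin_gt0_pi.
  by rewrite x0/= (lt_le_trans x2 (pi_ge2 R)).
rewrite ltr_norml => /andP[xl xu] s0; have [x0|x0|//] := ltgtP x 0.
  by move: n; rewrite s0 oppr0 ltxx => /(_ ltac:(lra)).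
by move: p; rewrite s0 ltxx => /(_ ltac:(lra)).
Qed.

Lemma sin_cos_injective (a b : R) : `|a - b| < 2 ->
  sin a * cos b = cos a * sin b -> a = b.
Proof.
move=> ab h; apply/eqP; rewrite -subr_eq0; apply/eqP; apply: sin_small_eq0 => //.
by rewrite sinB h subrr.
Qed.

(** The hypothesis on sin (2 d) says that tan d is 0 or infinite. The type preserves this zero or
    pole, and a displacement below pi cannot reach another one. *)
Lemma same_type_difference psi phi p q : same_type psi phi ->
  `|(angle psi p - angle psi q) - (angle phi p - angle phi q)| < 2 ->
  sin (2 * (angle phi p - angle phi q)) = 0 ->
  angle psi p - angle psi q = angle phi p - angle phi q.
Proof.
move=> [sP cP _] small; rewrite sin_double => /eqP; rewrite !mulf_eq0 pnatr_eq0 /=.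
move=> /orP[]/eqP h; apply: sin_cos_injective => //.
  by have := sP _ _ h; rewrite /sind h mulr0 => ->; rewrite mul0r.
by have := cP _ _ h; rewrite /cosd h mulr0 => ->; rewrite mul0r.
Qed.

Definition tan_equation psi phi (k : 'I_3) :=
  sin (psi ord0 k) * sin (psi ord0 (k + 1) - psi ord0 (k + 2%:R)) *
    (cos (phi ord0 k) * cos (phi ord0 (k + 1) - phi ord0 (k + 2%:R))) =
  cos (psi ord0 k) * cos (psi ord0 (k + 1) - psi ord0 (k + 2%:R)) *
    (sin (phi ord0 k) * sin (phi ord0 (k + 1) - phi ord0 (k + 2%:R))).

Lemma same_type_tan psi phi k : same_type psi phi -> tan_equation psi phi k.
Proof.
move=> [_ _ /(_ (lift ord0 k) ord0 (lift ord0 (k + 1)%R) (lift ord0 (k + 2%:R)%R))].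
rewrite /sin_product /cos_product /sind /cosd !angle0 !angleS !subr0; apply.
by case: k => -[|[|[|//]]].
Qed.

Definition close (e : R) psi phi := forall k, `|psi ord0 k - phi ord0 k| < e.

Lemma near_close phi e : 0 < e -> \forall psi \near phi, close e psi phi.
Proof.
move=> e0; apply: (@filter_forall _ _ (fun k psi => `|psi ord0 k - phi ord0 k| < e) (nbhs phi) _)
  => k.
have /cvgrPdist_lt/(_ e e0) := @coord_continuous R 1 3 ord0 k phi.
by apply: filterS => psi; rewrite distrC.
Qed.

Lemma eq_ord3 (psi phi : 'rV[R]_3) k : psi ord0 k = phi ord0 k ->
  psi ord0 (k + 1) = phi ord0 (k + 1) -> psi ord0 (k + 2%:R) = phi ord0 (k + 2%:R) ->
  psi = phi.
Proof.
move=> h0 h1 h2; apply/rowP => j; have : j \in [:: k; k + 1; k + 2%:R].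
  by move: k j {h0 h1 h2} => -[[|[|[|//]]] ?] [[|[|[|//]]] ?].
by rewrite !inE => /or3P[]/eqP ->.
Qed.

Lemma same_type_coordinate psi phi k : same_type psi phi ->
  `|psi ord0 k - phi ord0 k| < 2 -> sin (2 * phi ord0 k) = 0 -> psi ord0 k = phi ord0 k.
Proof.
move=> st small s0; have := same_type_difference (p := lift ord0 k) (q := ord0) st.
by rewrite !angleS !angle0 !subr0; apply.
Qed.

Lemma same_type_coordinate_difference psi phi j k : same_type psi phi -> close 1 psi phi ->
  sin (2 * (phi ord0 j - phi ord0 k)) = 0 ->
  psi ord0 j - psi ord0 k = phi ord0 j - phi ord0 k.
Proof.
move=> st small s0; have := same_type_difference (p := lift ord0 j) (q := lift ord0 k) st.
rewrite !angleS; apply=> //.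
have := small j; have := small k; rewrite !ltr_norml => /andP[? ?] /andP[? ?].
by apply/andP; split; lra.
Qed.

(** Equality of tan^2 amounts to sin (a - b) sin (a + b) = 0. *)
Lemma sin_cos_sqr_injective (a b : R) : `|a - b| < 2 -> sin (a + b) != 0 ->
  sin a ^+ 2 * cos b ^+ 2 = cos a ^+ 2 * sin b ^+ 2 -> a = b.
Proof.
move=> ab s0 h; apply: sin_cos_injective => //; apply: (mulfI s0); rewrite sinD.
apply/eqP; rewrite -subr_eq0; apply/eqP.
by transitivity (sin a ^+ 2 * cos b ^+ 2 - cos a ^+ 2 * sin b ^+ 2); [ring|rewrite h subrr].
Qed.

(* At a zero of Z the type fixes one coordinate y and a difference z - x of the two
   others, and the tangent equation gives x. *)
Lemma same_type_zero psi phi : vector_field_Z phi = 0 -> same_type psi phi ->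
  close 1 psi phi ->
  (forall k, sin (phi ord0 k + phi ord0 k) != 0 -> sin (psi ord0 k + phi ord0 k) != 0) ->
  psi = phi.
Proof.
move=> Z0 st cl nz.
have cl2 k : `|psi ord0 k - phi ord0 k| < 2 by apply: (lt_trans (cl k)); lra.
have lock k := same_type_coordinate st (cl2 k).
have Zk k : sin (2 * phi ord0 k) = 0 \/ speed phi k = 0.
  have := vector_field_ZE phi k; rewrite Z0 mxE => /esym/eqP; rewrite mulf_eq0.
  by move=> /orP[]/eqP; [left|right].
have [all0|] := pselect (forall k, sin (2 * phi ord0 k) = 0).
  by apply/rowP => k; exact: lock.
move=> /existsNP[k /eqP sk].
have [/eqP|sp] := Zk k; first by rewrite (negbTE sk).
have nzk : sin (psi ord0 k + phi ord0 k) != 0.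
  by apply: nz; rewrite -mulr2n -mulr_natl.
have tk := same_type_tan k st.
have lockd j i := same_type_coordinate_difference (j := j) (k := i) st cl.
have := Zk (k + 1); have := Zk (k + 2%:R).
have [k11 k12 k21 k22] := ord3_cycle k.
move: sp (lock (k + 1)) (lock (k + 2%:R)) (lockd (k + 2%:R) k) (lockd (k + 1) k) tk (cl2 k) nzk sk.
rewrite /speed /tan_equation k11 k12 k21 k22 => sp lk1 lk2 ld2 ld1 tk clk nzk sk h2 h1.
suff : [/\ psi ord0 k = phi ord0 k, psi ord0 (k + 1) = phi ord0 (k + 1) &
  psi ord0 (k + 2%:R) = phi ord0 (k + 2%:R)] by move=> []; exact: eq_ord3.
move: (phi ord0 k) (phi ord0 (k + 1)) (phi ord0 (k + 2%:R)) (psi ord0 k) (psi ord0 (k + 1))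
  (psi ord0 (k + 2%:R)) sp lk1 lk2 ld2 ld1 tk clk nzk sk h2 h1.
move=> x y z x' y' z' sp lk1 lk2 ld2 ld1 tk clk nzk sk h2 h1.
have sp2 : sin (2 * (y + z - x)) = 0 by rewrite sin_double sp mulr0 mul0r.
have cos_neq0 (e : R) : sin e = 0 -> cos e != 0.
  by move=> s0; apply/eqP => c0; have := cos2Dsin2 e; rewrite s0 c0; lra.
(* Otherwise both other speeds vanish; their arguments add up to [2 * x], whose sine is nonzero. *)
have [sy|sz] : sin (2 * y) = 0 \/ sin (2 * z) = 0.
  have [|s1] := h1; first by left.
  have [|s2] := h2; first by right.
  have := sin_sum_eq0 s1 s2; have -> : z + x - y + (x + y - z) = 2 * x by ring.
  by move=> /eqP; rewrite (negbTE sk).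
- have yy := lk1 sy; have zx : z' - x' = z - x.
    apply: ld2; have -> : 2 * (z - x) = 2 * (y + z - x) + - (2 * y) by ring.
    by apply: sin_sum_eq0 => //; rewrite sinN sy oppr0.
  (* With y and z - x locked, the difference y - z is [e - x] and y' - z' is [e - x']. Since sin e =
     0, tan (e - x) is - tan x, and the tangent equation becomes an equality of squares of
     tangents. *)
  have [e eE] : exists e, e = 2 * y - (y + z - x) by exists (2 * y - (y + z - x)).
  have se : sin e = 0 by rewrite eE; apply: sin_sum_eq0; rewrite ?sinN ?sp ?oppr0.
  have xx : x' = x.
    apply: sin_cos_sqr_injective => //.
    move: tk; have -> : y' - z' = e - x' by rewrite yy eE; lra.
    have -> : y - z = e - x by rewrite eE; ring.
    rewrite !sinB !cosB se => tk.
    have ce2 : cos e ^+ 2 != 0 by rewrite expf_neq0// cos_neq0.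
    by apply: (mulfI ce2); apply: oppr_inj; apply: (etrans _ (etrans tk _)); ring.
  by split=> //; lra.
- have zz := lk2 sz; have yx : y' - x' = y - x.
    apply: ld1; have -> : 2 * (y - x) = 2 * (y + z - x) + - (2 * z) by ring.
    by apply: sin_sum_eq0 => //; rewrite sinN sz oppr0.
  have [e eE] : exists e, e = (y + z - x) - 2 * z by exists ((y + z - x) - 2 * z).
  have se : sin e = 0 by rewrite eE; apply: sin_sum_eq0; rewrite ?sinN ?sz ?oppr0.
  have xx : x' = x.
    apply: sin_cos_sqr_injective => //.
    move: tk; have -> : y' - z' = e + x' by rewrite zz eE; lra.
    have -> : y - z = e + x by rewrite eE; ring.
    rewrite !sinD !cosD se => tk.
    have ce2 : cos e ^+ 2 != 0 by rewrite expf_neq0// cos_neq0.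
    by apply: (mulfI ce2); apply: (etrans _ (etrans tk _)); ring.
  by split=> //; lra.
Qed.

(* With x = phi_k and y - z = phi_l - phi_m fixed, the two other tangent equations
   only involve y + z - x, through its cosine. *)
Lemma tan_equation_unique psi phi k : psi ord0 k = phi ord0 k ->
  (forall j, tan_equation psi phi j) -> close (1 / 2) psi phi ->
  sin (2 * phi ord0 k) != 0 ->
  sin (((psi ord0 (k + 1) + psi ord0 (k + 2%:R) - psi ord0 k) +
    (phi ord0 (k + 1) + phi ord0 (k + 2%:R) - phi ord0 k)) / 2) != 0 ->
  psi = phi.
Proof.
move=> xx te cl sk sY.
have := te (k + 2%:R); have := te (k + 1); have := te k.
have := cl (k + 1); have := cl (k + 2%:R).
have [k11 k12 k21 k22] := ord3_cycle k.
move: xx sk sY; rewrite /tan_equation k11 k12 k21 k22 => xx sk sY cz cy t0 t1 t2.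
suff : [/\ psi ord0 k = phi ord0 k, psi ord0 (k + 1) = phi ord0 (k + 1) &
  psi ord0 (k + 2%:R) = phi ord0 (k + 2%:R)] by move=> []; exact: eq_ord3.
move: (phi ord0 k) (phi ord0 (k + 1)) (phi ord0 (k + 2%:R)) (psi ord0 k) (psi ord0 (k + 1))
  (psi ord0 (k + 2%:R)) xx sk sY cz cy t0 t1 t2.
move=> x y z x' y' z' -> sk sY; rewrite !ltr_norml => /andP[cz1 cz2] /andP[cy1 cy2] t0 t1 t2.
have dd : y' - z' = y - z.
  apply: sin_cos_injective; first by rewrite ltr_norml; apply/andP; split; lra.
  have : (sin (2 * x)) / 2 != 0 by rewrite mulf_neq0// invr_eq0 pnatr_eq0.
  by rewrite sin_double => h; apply: (mulfI h); apply: (etrans _ (etrans t0 _)); field.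
(* The product formulas put the remaining tangent equations in this shape, with [Y] the argument of
   the speed and [c] = x + (y - z) or x - (y - z). *)
have trig1 (c Y Y' : R) : (cos c - cos Y') / 2 * ((cos c + cos Y) / 2) =
    (cos c + cos Y') / 2 * ((cos c - cos Y) / 2) -> cos c * (cos Y' - cos Y) = 0.
  by move=> /eqP; rewrite -subr_eq0 => /eqP E; rewrite -[RHS](mulr0 (-2)) -E; field.
have cc (a b : R) : cos a * cos b = (cos (a - b) + cos (a + b)) / 2.
  by rewrite cosB cosD; field.
have c1 : cos (y - z + x) * (cos (y' + z' - x) - cos (y + z - x)) = 0.
  apply: trig1; move: t1; rewrite !sinMsin !cc.
  have -> : y' - (z' - x) = y' - z' + x by ring.
  have -> : y - (z - x) = y - z + x by ring.
  by rewrite dd !addrA.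
have c2 : cos (z - y + x) * (cos (y' + z' - x) - cos (y + z - x)) = 0.
  apply: trig1; move: t2; rewrite !sinMsin !cc.
  have -> : z' - (x - y') = y' + z' - x by ring.
  have -> : z - (x - y) = y + z - x by ring.
  have -> : z' + (x - y') = - (y' - z') + x by ring.
  have -> : z + (x - y) = z - y + x by ring.
  by rewrite dd opprB => h; lra.
(* The two values of [c] add up to [2 * x], so both cosines cannot vanish. *)
have cY : cos (y' + z' - x) - cos (y + z - x) = 0.
  move: c1 c2 => /eqP; rewrite mulf_eq0 => /orP[/eqP a0|/eqP//] /eqP.
  rewrite mulf_eq0 => /orP[/eqP b0|/eqP//].
  move: sk; have -> : 2 * x = (y - z + x) + (z - y + x) by ring.
  by rewrite sinD a0 b0 mul0r mulr0 addr0 eqxx.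
(* The difference of cosines factors through the sines of the half sum [u] and the half difference
   [v]; [sY] rules out the first. *)
have YY : y' + z' - x = y + z - x.
  pose u := ((y' + z' - x) + (y + z - x)) / 2; pose v := ((y' + z' - x) - (y + z - x)) / 2.
  have v0 : v = 0.
    apply: sin_small_eq0; first by rewrite ltr_norml /v; apply/andP; split; lra.
    apply: (mulfI sY); rewrite mulr0 -/u sinMsin.
    have -> : u - v = y + z - x by rewrite /u /v; field.
    have -> : u + v = y' + z' - x by rewrite /u /v; field.
    by lra.
  by move: v0; rewrite /v => v0; lra.
by split=> //; lra.
Qed.

(** With a nonzero derivative, [f 0] is neither a minimum nor a maximum on the interval. Values on
    both sides are attained, and the intermediate value theorem fills the gap. *)
Lemma nonzero_derivative_covers (f df : R -> R) (delta : R) :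
  (forall s, is_derive s (1 : R) f (df s)) -> df 0 != 0 -> 0 < delta ->
  exists2 e, 0 < e & forall y, `|y - f 0| < e -> exists2 s, `|s| < delta & f s = y.
Proof.
move=> fd df0 delta0.
have in0 : (0 : R) \in `]- delta, delta[ by rewrite in_itv/= delta0 oppr_lt0 delta0.
have le0 : - delta <= delta by lra.
have der (t : R) : derivable f t 1 by have [] := fd t.
have val : 'D_1 f (0 : R) = df 0 by have [] := fd 0.
have [a ad fa] : exists2 a, a \in `]- delta, delta[ & f a < f 0.
  apply: contrapT => no; move: df0; rewrite -val.
  have [|_ ->] := @derive1_at_min R f (- delta) delta 0 le0 (fun t _ => der t) in0;
    last by rewrite eqxx.
  by move=> t td; rewrite leNgt; apply/negP => ft; apply: no; exists t.
have [b bd fb] : exists2 b, b \in `]- delta, delta[ & f 0 < f b.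
  apply: contrapT => no; move: df0; rewrite -val.
  have [|_ ->] := @derive1_at_max R f (- delta) delta 0 le0 (fun t _ => der t) in0;
    last by rewrite eqxx.
  by move=> t td; rewrite leNgt; apply/negP => ft; apply: no; exists t.
exists (Num.min (f 0 - f a) (f b - f 0)); first by rewrite lt_min !subr_gt0 fa fb.
move=> y; rewrite lt_min !ltr_norml => /andP[/andP[ya _] /andP[_ yb]].
have cf : continuous f by move=> s; exact: is_derive_continuous (fd s).
have inb (u v w : R) : u \in `]- delta, delta[ -> v \in `]- delta, delta[ ->
    w \in `[u, v] -> `|w| < delta.
  rewrite !in_itv/= ltr_norml => /andP[u1 u2] /andP[v1 v2] /andP[w1 w2].
  by apply/andP; split; lra.
have cut u v : u <= v -> {within `[u, v], continuous f} by move=> _; exact: continuous_subspaceT.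
have [ab|/ltW ba] := leP a b.
- have [|s sab fs] := IVT ab (cut _ _ ab) (v := y); last by exists s => //; exact: inb sab.
  by rewrite ge_min le_max; apply/andP; split; apply/orP; [left|right]; lra.
- have [|s sab fs] := IVT ba (cut _ _ ba) (v := y); last by exists s => //; exact: inb sab.
  by rewrite ge_min le_max; apply/andP; split; apply/orP; [right|left]; lra.
Qed.

(** Both sides pick up the same factor [p k * q k], so the reference point can be moved along the
    flow. *)
Lemma flow_tan_equation phi chi p q r : (forall k, [/\ 0 < p k, 0 < q k & 0 < r k]) ->
  proportional phi chi p q r ->
  forall psi k, tan_equation psi phi k -> tan_equation psi chi k.
Proof.
move=> pos prop psi k; rewrite /tan_equation; have [c1 s1 c2 s2] := prop k.
have [_ _ /lt0r_neq0 r0] := pos k.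
rewrite c1 s1 c2 s2 => h.
transitivity (p k * q k * (sin (psi ord0 k) * sin (psi ord0 (k + 1) - psi ord0 (k + 2%:R)) *
    (cos (phi ord0 k) * cos (phi ord0 (k + 1) - phi ord0 (k + 2%:R))))); first by ring.
by rewrite h; field.
Qed.

(** The flow is followed to a time [s] when its k-th coordinate equals that of [psi];
    [tan_equation_unique] then identifies the two points. *)
Lemma near_orbit_nonzero phi k : vector_field_Z phi ord0 k != 0 ->
  \forall psi \near phi, same_type psi phi -> flow_orbit (torus_point phi) (torus_point psi).
Proof.
move=> Zk; have [gamma g0 gZ] := integral_curve_exists phi.
have := Zk; rewrite vector_field_ZE mulf_eq0 negb_or => /andP[sk spk].
pose Y (chi : 'rV[R]_3) := chi ord0 (k + 1) + chi ord0 (k + 2%:R) - chi ord0 k.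
have [e0 e00 sY] : exists2 e : R, 0 < e & forall y, `|y - Y phi| < e -> sin y != 0.
  have /nbhs_ballP[e /= e0 h] : \forall y \near Y phi, sin y != 0.
    exact: cvgr_neq0 (@continuous_sin R (Y phi)) spk.
  by exists e => // y ye; apply: h; rewrite /ball/= distrC.
(* 1/8 keeps [psi] and [gamma s] within 1/2 of each other. With e0/8, the three-term sums [Y psi]
   and [Y (gamma s)], hence their mean, stay within [e0] of [Y phi]. *)
pose e := Num.min (1 / 8) (e0 / 8).
have e_gt0 : 0 < e by rewrite lt_min; apply/andP; split; lra.
have [delta delta0 gc] : exists2 delta : R, 0 < delta &
    forall s, `|s| < delta -> close e (gamma s) phi.
  have /nbhs_ballP[d /= d0 h] : \forall s \near (0 : R), close e (gamma s) phi.
    apply: (@filter_forall _ _ (fun j s => `|gamma s ord0 j - phi ord0 j| < e) (nbhs 0) _) => j.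
    have /cvgrPdist_lt/(_ e e_gt0) := @curve_continuous _ _ gZ j 0.
    by apply: filterS => s; rewrite g0 distrC.
  by exists d => // s sd; apply: h; rewrite /ball/= sub0r normrN.
have [|eps eps0 cover] := nonzero_derivative_covers (fun s => curve_coordinate gZ k s) _ delta0.
  by rewrite g0 -vector_field_ZE.
apply: filterS2 (near_close phi e_gt0) (near_close phi eps0) => psi ce ceps st.
have [s sd gs] := cover (psi ord0 k) ltac:(by rewrite g0; exact: ceps).
have [p [q [r [pos prop]]]] := flow_proportional gZ s; rewrite g0 in prop.
exists gamma; split=> //; first by rewrite g0.
exists s; congr torus_point; apply: esym.
have bd j : `|psi ord0 j - gamma s ord0 j| < 1 / 2 /\
    - (e0 / 8) < psi ord0 j - phi ord0 j < e0 / 8 /\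
    - (e0 / 8) < gamma s ord0 j - phi ord0 j < e0 / 8.
  have := ce j; have := gc s sd j; rewrite /e !lt_min !ltr_norml.
  move=> /andP[/andP[a1 a2] /andP[a3 a4]] /andP[/andP[b1 b2] /andP[b3 b4]].
  by split; [apply/andP; split; lra|split; apply/andP; split; lra].
apply: (@tan_equation_unique psi (gamma s) k); first by rewrite gs.
- by move=> j; apply: (flow_tan_equation pos prop); exact: same_type_tan.
- by move=> j; have [] := bd j.
- move: sk; rewrite !sin_double; have [-> _ _ ->] := prop k; have [p0 q0 r0] := pos k.
  have -> : 2 * (q k / r k * sin (phi ord0 k)) * (p k * cos (phi ord0 k)) =
    q k / r k * p k * (2 * sin (phi ord0 k) * cos (phi ord0 k)) by ring.
  by move=> sk; rewrite mulf_neq0// lt0r_neq0// mulr_gt0// divr_gt0.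
- apply: sY; rewrite -/(Y psi) -/(Y (gamma s)) ltr_norml /Y.
  have [_ [/andP[a1 a2] /andP[a3 a4]]] := bd k.
  have [_ [/andP[b1 b2] /andP[b3 b4]]] := bd (k + 1).
  have [_ [/andP[c1 c2] /andP[c3 c4]]] := bd (k + 2%:R).
  by apply/andP; split; lra.
Qed.

Lemma near_same_type_orbit phi : \forall psi \near phi,
  same_type psi phi -> flow_orbit (torus_point phi) (torus_point psi).
Proof.
have [Z0|/eqP/rowP Z0] := eqVneq (vector_field_Z phi) 0; last first.
  have [k Zk] : exists k, vector_field_Z phi ord0 k != 0.
    apply: contrapT => no; apply: Z0 => k.
    by rewrite [RHS]mxE; apply/eqP/negPn/negP => Zk; apply: no; exists k.
  exact: near_orbit_nonzero Zk.
have nz := @near_imply_neq0 'I_3 (fun k psi => sin (psi ord0 k + phi ord0 k)) phi.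
apply: filterS2 (near_close phi ltr01) (nz _) => [psi cl sn st|k psi].
  rewrite (same_type_zero Z0 st cl sn).
  have [gamma g0 gZ] := integral_curve_exists phi.
  by exists gamma; split=> //; [rewrite g0|exists 0; rewrite g0].
apply: (@continuous_comp _ _ _ (fun psi => psi ord0 k + phi ord0 k) sin).
  by apply: continuousD; [exact: coord_continuous|exact: (@cst_continuous _ _ (phi ord0 k) psi)].
exact: continuous_sin.
Qed.

Lemma flow_orbit_scale_equivalent (u v : 'rV[R[i]^o]_3) : flow_orbit u v -> scale_equivalent v u.
Proof.
move=> [gamma [gZ <- [t <-]]].
have [p [q [r [pos prop]]]] := flow_proportional gZ t.
exact: proportional_scale_equivalent pos prop.
Qed.

Lemma near_rigidity phi : \forall psi \near phi,
  scale_equivalent (torus_point psi) (torus_point phi) <->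
  flow_orbit (torus_point phi) (torus_point psi).
Proof.
apply: filterS2 (near_same_type phi) (near_same_type_orbit phi) => psi st fo.
by split=> [/st/fo//|]; exact: flow_orbit_scale_equivalent.
Qed.
End LocalRigidity.

(** * Angles as local coordinates on the torus *)

Section TorusChart.
Variable R : realType.
Implicit Types (phi psi : 'rV[R]_3) (z : R[i]).

Lemma norm1_sqr z : `|z| = 1 -> complex.Re z ^+ 2 + complex.Im z ^+ 2 = 1.
Proof.
case: z => a b; rewrite normc_def /= => /(congr1 (@complex.Re R))/= h.
by rewrite -[LHS]sqr_sqrtr ?h ?expr1n// addr_ge0// sqr_ge0.
Qed.

Lemma norm_expi (x : R) : `|expi x| = 1.
Proof. by rewrite normc_def /= cos2Dsin2 sqrtr1. Qed.

Lemma expi_surjective z : `|z| = 1 -> exists x, expi x = z.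
Proof.
move=> /norm1_sqr; case: z => a b /= ab.
have a1 : -1 <= a <= 1 by apply/andP; split; nra.
have b2 : b ^+ 2 = 1 - a ^+ 2 by rewrite -ab addrC addKr.
have cosE := acosK (x := a); have sinE := sin_acos a1.
rewrite -b2 sqrtr_sqr in sinE.
have [b0|/ltW b0] := leP 0 b.
  by exists (acos a); rewrite /expi cosE ?in_itv// sinE ger0_norm.
by exists (- acos a); rewrite /expi cosN sinN cosE ?in_itv// sinE ler0_norm// opprK.
Qed.

Lemma Im_le_normc z : (`|complex.Im z|)%:C%C <= `|z|.
Proof.
rewrite normc_def lecR -sqrtr_sqr ler_wsqrtr// lerDr sqr_ge0//.
Qed.

(* The angle of z relative to expi x is the arcsine of the imaginary part of
   z / expi x. *)
Lemma expi_local_lift (x e : R) : 0 < e -> exists2 d : R, 0 < d &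
  forall z, `|z| = 1 -> `|expi x - z| < d%:C%C -> exists2 y, `|y - x| < e & expi y = z.
Proof.
move=> e0.
have /cvgrPdist_lt/(_ e e0)/nbhs_ballP[d /= d0 asd] :=
  @continuous_asin R 0 ltac:(by rewrite ltrN10 ltr01).
(* 1/4 makes the real part [a] of the quotient nonnegative, so that the arcsine of [b] is its angle;
   d/2 bounds each of the two terms of [b]. *)
exists (Num.min (1 / 4) (d / 2)); first by rewrite lt_min; apply/andP; split; lra.
case=> c1 c2 /norm1_sqr /= n1 zd.
have [r1 i1] : `|cos x - c1| < Num.min (1 / 4) (d / 2) /\ `|sin x - c2| < Num.min (1 / 4) (d / 2).
  rewrite -!ltcR; split; apply: le_lt_trans zd; first exact: (normc_ge_Re (expi x - (c1 +i* c2)%C)).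
  exact: (Im_le_normc (expi x - (c1 +i* c2)%C)).
pose a := c1 * cos x + c2 * sin x; pose b := c2 * cos x - c1 * sin x.
have cs := cos2Dsin2 x.
have ab : a ^+ 2 + b ^+ 2 = 1.
  transitivity ((c1 ^+ 2 + c2 ^+ 2) * (cos x ^+ 2 + sin x ^+ 2)); first by rewrite /a /b; ring.
  by rewrite n1 cs mulr1.
have small (f g m : R) : `|f| < m -> `|g| <= 1 -> `|f * g| < m.
  by move=> fm g1; rewrite normrM (le_lt_trans _ fm)// ler_piMr.
have s1 : `|sin x| <= 1 by rewrite ler_norml sin_geN1 sin_le1.
have k1 : `|cos x| <= 1 by rewrite ler_norml cos_geN1 cos_le1.
have bE : b = (sin x - c2) * - cos x + (cos x - c1) * sin x by rewrite /b; ring.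
have aE : a = 1 - ((cos x - c1) * cos x + (sin x - c2) * sin x) by rewrite /a -cs; ring.
have nk1 : `|- cos x| <= 1 by rewrite normrN.
have := small _ _ _ r1 k1; have := small _ _ _ r1 s1.
have := small _ _ _ i1 nk1; have := small _ _ _ i1 s1.
rewrite !lt_min !ltr_norml.
move=> /andP[/andP[p1 p2] _] /andP[_ /andP[p3 p4]] /andP[_ /andP[p5 p6]] /andP[/andP[p7 p8] _].
have bd : `|b| < d by rewrite bE ltr_norml; apply/andP; split; lra.
have a0 : 0 <= a by rewrite aE; lra.
have b1 : -1 <= b <= 1 by apply/andP; split; nra.
have sinb : sin (asin b) = b by apply: asinK; rewrite in_itv.
have cosb : cos (asin b) = a.
  by rewrite cos_asin// -ab addrK sqrtr_sqr ger0_norm.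
have asin0 : asin (0 : R) = 0.
  by rewrite -[X in asin X]sin0 sinK// in_itv/=; have := pi_ge0 R; move=> p; apply/andP; split; lra.
exists (x + asin b).
  have := asd b; rewrite asin0 /ball/= !sub0r !normrN => /(_ bd).
  by have -> : x + asin b - x = asin b by ring.
rewrite /expi cosD sinD sinb cosb /a /b; congr (_ +i* _)%C.
  transitivity (c1 * (cos x ^+ 2 + sin x ^+ 2)); first by ring.
  by rewrite cs mulr1.
transitivity (c2 * (cos x ^+ 2 + sin x ^+ 2)); first by ring.
by rewrite cs mulr1.
Qed.

Lemma torus_point_Sigma phi : Sigma (torus_point phi).
Proof. by move=> k; rewrite mxE norm_expi. Qed.

Lemma torus_point_surjective (u : 'rV[R[i]^o]_3) : Sigma u -> exists phi, u = torus_point phi.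
Proof.
move=> Su; have /choice[f fE] := fun k => expi_surjective (Su k); exists (\row_k f k).
by apply/rowP => k; rewrite !mxE fE.
Qed.

(** The angle map is open onto Sigma, as each coordinate of a nearby point of the torus lifts to a
    nearby angle. It carries statements near [phi] to the torus. *)
Lemma torus_point_open phi (P : set 'rV[R]_3) : nbhs phi P ->
  within (@Sigma R) (nbhs (torus_point phi)) (@torus_point R @` P).
Proof.
move=> /nbhs_ballP[e /= e0 eP].
have /choice[d dP] k : exists d : R, 0 < d /\ forall z, `|z| = 1 ->
    `|expi (phi ord0 k) - z| < d%:C%C -> exists2 y, `|y - phi ord0 k| < e & expi y = z.
  by have [d d0 h] := expi_local_lift (phi ord0 k) e0; exists d.
have : \forall v \near torus_point phi, forall k : 'I_3,
    `|expi (phi ord0 k) - (v : 'rV[R[i]^o]_3) ord0 k| < (d k)%:C%C.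
  apply: (@filter_forall _ _ (fun k (v : 'rV[R[i]^o]_3) => `|expi (phi ord0 k) - v ord0 k| < (d k)%:C%C)
    (nbhs _) _) => k.
  have d0 : 0 < (d k)%:C%C by rewrite ltcR; have [] := dP k.
  have /cvgrPdist_lt/(_ _ d0) := @coord_continuous R[i] 1 3 ord0 k (torus_point phi).
  by apply: filterS => v; rewrite mxE.
apply: filterS => v vd Sv.
have /choice[f fP] k : exists y, `|y - phi ord0 k| < e /\ expi y = v ord0 k.
  by have [_ /(_ _ (Sv k) (vd k))[y]] := dP k; exists y.
exists (\row_k f k); last by apply/rowP => k; rewrite !mxE; have [] := fP k.
apply: eP; split=> // i j; rewrite (ord1 i) mxE /ball/= distrC; by have [] := fP j.
Qed.
End TorusChart.

Theorem theorem3 (R : realType) (u : 'rV[R[i]^o]_3) (hu : Sigma u) :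
  exists V : set 'rV[R[i]^o]_3,
    [/\ V `<=` @Sigma R,
        within (@Sigma R) (nbhs u) V
      & forall v : 'rV[R[i]^o]_3, V v ->
          (scale_equivalent v u <-> flow_orbit u v)].
Proof.
have [phi ->] := torus_point_surjective hu.
(* The condition on [psi] depends only on its torus point, so one good lift suffices for each point
   of V. *)
exists (@torus_point R @` [set psi | scale_equivalent (torus_point psi) (torus_point phi) <->
  flow_orbit (torus_point phi) (torus_point psi)]); split.
- by move=> _ [psi _ <-]; exact: torus_point_Sigma.
- exact: torus_point_open (near_rigidity phi).
- by move=> _ [psi ? <-].
Qed.
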